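(* Suppose builder values $v_1,\dots,v_n$ are independent and atomless with densities. Then there exists a revenue-maximizing full-commitment ePBS mechanism that implements the static Myerson optimal auction (with ironing when needed) at stage 1 and immediately proposes the winning bid, if any.
   Context: Full-commitment ePBS mechanism. Before bids arrive, the proposer commits to a possibly randomized direct mechanism. Builders $i=1,\dots,n$ privately observe $v_i\sim F_i$ (density $f_i$) and report values. For each reported profile $v$, the mechanism chooses a terminal stage $t\in\{1,2\}$, with $q_{i,t}(v)\ge0$ the (unconditional) probability that builder $i$ wins at terminal stage $t$, subject to $\sum_i\sum_tq_{i,t}(v)\le1$ (no allocation is allowed), and $p_{i,t}(v)$ builder $i$'s (unconditional expected) stage-$t$ payment. Stage-$t$ outcomes carry canonicalization weight $k_t$, with $1\ge k_1\ge k_2\ge0$: builder $i$'s payoff is $v_i\sum_tk_tq_{i,t}-\sum_tk_tp_{i,t}$, and the proposer's revenue is $\sum_i\sum_tk_tp_{i,t}$. The mechanism must be Bayesian incentive compatible (truthful reporting is a Bayes–Nash equilibrium) and interim individually rational; ''revenue-maximizing'' means maximizing expected proposer revenue over all such mechanisms. Static Myerson optimal auction: with virtual values $\varphi_i(v_i)=v_i-\frac{1-F_i(v_i)}{f_i(v_i)}$ (replaced by their ironed versions when not weakly increasing), allocate to a builder with the highest virtual value if it is nonnegative (fixed tie-breaking), allocate to nobody otherwise, and charge the corresponding Myerson (envelope) payments.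
   Formalization: Builder values are additionally assumed to have finite mean; without this the claim fails, e.g. for one builder with 1-F(x)=x^{-1/2} on [1,∞), where posted-price revenue is unbounded and the ironed auction is undefined. *)

(* Defs.v *)
From HB Require Import structures.
From mathcomp Require Import all_boot all_order all_algebra.
From mathcomp Require Import all_classical all_reals all_analysis.

Set Implicit Arguments.
Unset Strict Implicit.
Unset Printing Implicit Defensive.

Import Order.TTheory GRing.Theory Num.Theory.

Local Open Scope classical_set_scope.
Local Open Scope ring_scope.

Definition stage := 'I_2.
Definition stage1 : stage := ord0.
Definition stage2 : stage := ord_max.

Definition profile (R : realType) (n : nat) := n.-tuple (measurableTypeR R).

Definition profiles (R : realType) (n : nat) (T : 'I_n -> set R) :
  set (profile R n) := [set v | forall i, T i (tnth v i)].

(* The profile (r, v_{-i}). *)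
Definition deviate (R : realType) (n : nat) (v : profile R n) (i : 'I_n)
  (r : R) : profile R n := [tuple if j == i then r else tnth v j | j < n].

(* A randomized direct mechanism, given by its reduced form: [win M i t v] is
   the unconditional probability that [i] wins at terminal stage [t], and
   [pay M i t v] the unconditional expected stage-[t] payment of [i]. *)
Record mechanism (R : realType) (n : nat) := Mechanism {
  win : 'I_n -> stage -> profile R n -> R ;
  pay : 'I_n -> stage -> profile R n -> R }.

Section values.
Context (d : measure_display) (Omega : measurableType d) (R : realType)
  (P : probability Omega R) (n : nat) (V : 'I_n -> {RV P >-> R}).

(* Mutual independence; subfamilies are covered by taking [A i := setT]. *)
Definition independent_values := forall A : 'I_n -> set R,
  (forall i, measurable (A i)) ->
  P (\bigcap_(i in [set: 'I_n]) (V i @^-1` A i)) =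
  (\prod_(i < n) P (V i @^-1` A i))%E.

Definition has_density (X : {RV P >-> R}) (f : R -> R) :=
  [/\ measurable_fun [set: R] f, (forall x, 0 <= f x) &
      forall A : set R, measurable A ->
        P (X @^-1` A) = (\int[lebesgue_measure]_(x in A) (f x)%:E)%E].

Definition value_profile (w : Omega) : profile R n := [tuple V i w | i < n].

Section mechanisms.
Context (k : stage -> R) (T : 'I_n -> set R).

Definition weighted_win (M : mechanism R n) (i : 'I_n) (v : profile R n) : R :=
  \sum_(t : stage) k t * win M i t v.

Definition weighted_pay (M : mechanism R n) (i : 'I_n) (v : profile R n) : R :=
  \sum_(t : stage) k t * pay M i t v.

(* The last three conditions ensure that interim payoffs and expected revenue
   are defined. *)
Definition feasible (M : mechanism R n) :=
  [/\ (forall v, profiles T v -> forall i t, 0 <= win M i t v),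
      (forall v, profiles T v -> \sum_(i < n) \sum_(t : stage) win M i t v <= 1),
      (forall i t, measurable_fun (profiles T) (win M i t)),
      (forall i t, measurable_fun (profiles T) (pay M i t)) &
      (forall i, P.-integrable [set: Omega]
         (fun w => (weighted_pay M i (value_profile w))%:E) /\
       forall r, T i r -> P.-integrable [set: Omega]
         (fun w => (weighted_pay M i (deviate (value_profile w) i r))%:E))].

(* Expected payoff of builder [i] of value [x] who reports [r] while the others
   are truthful.  The expectation is over the others' values only, so that, by
   independence, no conditioning on the value of [i] is needed. *)
Definition interim_payoff (M : mechanism R n) (i : 'I_n) (x r : R) : \bar R :=
  'E_P[fun w => x * weighted_win M i (deviate (value_profile w) i r)
                - weighted_pay M i (deviate (value_profile w) i r)].

Definition bayesian_incentive_compatible (M : mechanism R n) :=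
  forall i x r, T i x -> T i r ->
    (interim_payoff M i x r <= interim_payoff M i x x)%E.

Definition interim_individually_rational (M : mechanism R n) :=
  forall i x, T i x -> (0 <= interim_payoff M i x x)%E.

Definition admissible (M : mechanism R n) :=
  [/\ feasible M, bayesian_incentive_compatible M &
      interim_individually_rational M].

Definition revenue (M : mechanism R n) : \bar R :=
  'E_P[fun w => \sum_(i < n) weighted_pay M i (value_profile w)].

Definition revenue_maximizing (M : mechanism R n) :=
  admissible M /\ forall M', admissible M' -> (revenue M' <= revenue M)%E.

End mechanisms.

Section virtual_values.
Context (X : {RV P >-> R}) (f : R -> R).

Definition dist_fun (x : R) : R := fine (cdf X x).

(* Extended-valued because [f] may vanish: as [0^-1 = +oo] and [0 * +oo = 0],
   the value at [x] with [f x = 0] is [-oo] if [dist_fun x < 1] (below the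
   support or in a gap) and [x] if [dist_fun x = 1]. *)
Definition virtual_value (x : R) : \bar R :=
  (x%:E - (1 - dist_fun x)%:E / (f x)%:E)%E.

Definition nondecreasing_virtual_value :=
  {homo virtual_value : x y / (x <= y)%R >-> (x <= y)%E}.

Definition quantile (s : R) : R := inf [set x | s <= dist_fun x].

(* Revenue in quantile space: posting the price sold to with probability [q].
   Where [f] is positive, its derivative at [1 - dist_fun x] is
   [virtual_value x]. *)
Definition revenue_curve (q : R) : R := q * quantile (1 - q).

(* Least concave majorant on [0, 1[, as the infimum of the affine majorants.
   The point q = 1 is left out since [quantile 0] is a junk value. *)
Definition ironed_revenue_curve (q : R) : R :=
  inf [set y | exists a b : R, y = a + b * q /\
         forall u : R, 0 <= u < 1 -> revenue_curve u <= a + b * u].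

(* Right derivative of the concave ironed revenue curve at 1 - F(x): the
   supremum of the slopes of its chords to the right of that point.  It is
   [-oo] if [dist_fun x = 0]. *)
Definition ironed_virtual_value (x : R) : \bar R :=
  let q := 1 - dist_fun x in
  ereal_sup [set ((ironed_revenue_curve q' - ironed_revenue_curve q)
                  / (q' - q))%:E | q' in [set q' | q < q' < 1]].

Definition myerson_value (x : R) : \bar R :=
  if `[< nondecreasing_virtual_value >] then virtual_value x else ironed_virtual_value x.

End virtual_values.

Section myerson.
Context (f : 'I_n -> R -> R) (rank : 'I_n -> nat).

Let psi (v : profile R n) (i : 'I_n) : \bar R :=
  myerson_value (V i) (f i) (tnth v i).

(* Ties are broken in favour of the builder of lowest [rank]. *)
Definition myerson_winner (v : profile R n) (i : 'I_n) : bool :=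
  (0 <= psi v i)%E &&
  [forall j : 'I_n, (j != i) ==>
     ((psi v j < psi v i)%E || (psi v j == psi v i) && (rank i < rank j)%N)].

Definition myerson_alloc (i : 'I_n) (v : profile R n) : R :=
  (myerson_winner v i)%:R.

(* The envelope formula.  Types below the support of [V i] have virtual value
   [-oo] and do not contribute to the integral. *)
Definition myerson_payment (i : 'I_n) (v : profile R n) : R :=
  tnth v i * myerson_alloc i v -
  \int[lebesgue_measure]_(s in `]-oo, tnth v i]) myerson_alloc i (deviate v i s).

(* The auction is held at stage 1, where the winning bid, if any, is proposed
   at once: nothing is allocated or paid at stage 2. *)
Definition implements_myerson_at_stage1 (T : 'I_n -> set R)
    (M : mechanism R n) :=
  forall v, profiles T v -> forall i,
    [/\ win M i stage1 v = myerson_alloc i v,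
        pay M i stage1 v = myerson_payment i v,
        win M i stage2 v = 0 & pay M i stage2 v = 0].

End myerson.

End values.

(* Main.v *)
(** Bulow and Roberts' reading of Myerson's auction: write [q x] for the
    probability that a builder accepts the price [x], and [profit c x] for
    [(x - c) * q x].  Whether or not ironing is needed, the threshold
    [inf {s | c <= phi s}] of the (ironed) virtual value [phi] is an optimal
    price for a seller of cost [c]; as a function of [c], the maximal profit has
    derivative [- P (c <= phi V)], so it equals the expectation of
    [max 0 (phi V - c)].  Hence the positive part of [phi V], integrated over the
    types accepting a price, is at least the revenue from that price, with
    equality at the thresholds of [phi].

    An incentive compatible mechanism is a mixture of posted prices as far as
    one builder is concerned, so its expected payment is at most the expectation
    of [max 0 (phi V)] times the weighted winning probability.  Summing over the
    builders, the weights being at most [k stage1], this is at most [k stage1]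
    times the largest positive virtual value, which the auction held at stage 1
    collects by charging threshold prices. *)

(* The obstacle is regularity: densities are merely measurable, demand is only continuous and may
   have flat pieces, and virtual values may be infinite. So nothing is differentiated: statements
   about derivatives become bounds on increments, and [le_of_increment_le] absorbs errors of second
   order. Plain and ironed virtual values reach the later sections only through monotonicity,
   negativity at negative values, and [optimal_pricing]. For ironed ones the latter holds because
   the maximal profit, as a function of the cost, is the conjugate of the revenue curve, and a curve
   and its least concave majorant have the same conjugate; no ironing interval is ever described.
   The mixture of posted prices is finite: the interim winning probability is cut into [N.+1] slices
   of equal height, at a rounding cost of at most the mean of [|X|] divided by [N.+1]. Independence
   enters by redrawing the value of one builder from a second copy of the probability space, after
   which Fubini separates it from the values of the rivals. *)
Require Import Defs.
From HB Require Import structures.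
From mathcomp Require Import all_boot all_order all_algebra.
From mathcomp Require Import all_classical all_reals all_analysis.
From mathcomp Require Import measurable_realfun ring lra.

Set Implicit Arguments.
Unset Strict Implicit.
Unset Printing Implicit Defensive.

Import Order.TTheory GRing.Theory Num.Theory.
Import numFieldNormedType.Exports.

Local Open Scope classical_set_scope.
Local Open Scope ring_scope.

(** * Posted prices *)

(* Over a subdivision of mesh [h], the increments add up to [h * (G b - G a)]. *)
Lemma le_of_increment_le (R : realType) (H G : R -> R) (a b : R) : a <= b ->
  (forall x y, a <= x -> x <= y -> y <= b ->
     H y - H x <= (y - x) * (G y - G x)) ->
  H b <= H a.
Proof.
move=> ab incr.
have step (N m : nat) : (m <= N.+1)%N ->
    H (a + m%:R * ((b - a) / N.+1%:R)) - H a
      <= (b - a) / N.+1%:R * (G (a + m%:R * ((b - a) / N.+1%:R)) - G a).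
  set h := (b - a) / N.+1%:R.
  have h0 : 0 <= h by rewrite divr_ge0// subr_ge0.
  have Nh : N.+1%:R * h = b - a by rewrite mulrCA divff ?mulr1// pnatr_eq0.
  elim: m => [_|m IH mN]; first by rewrite !mul0r !addr0 !subrr mulr0.
  have mh : 0 <= m%:R * h by rewrite mulr_ge0.
  have := incr (a + m%:R * h) (a + m.+1%:R * h).
  have -> : m.+1%:R * h = m%:R * h + h by rewrite -natr1 mulrDl mul1r.
  rewrite lerDl mh lerD2l lerDl h0.
  have -> : (a + (m%:R * h + h) <= b) = true.
    rewrite addrC -lerBrDr -Nh -{2}(mul1r h) -mulrDl natr1.
    by rewrite ler_wpM2r// ler_nat.
  move=> /(_ isT isT isT); have := IH (ltnW mN).
  have -> : a + (m%:R * h + h) - (a + m%:R * h) = h by ring.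
  set z := G (a + (_ + _)); set y := G (a + _); move=> i1 i2.
  have -> : h * (z - G a) = h * (y - G a) + h * (z - y) by ring.
  lra.
apply/ler_addgt0Pr => e e0.
set K := (b - a) * (G b - G a).
have [N NK] : exists N : nat, K / e < N%:R.
  by exists (Num.bound `|K / e|); rewrite (le_lt_trans (ler_norm _))// archi_boundP.
have := step N N.+1 (leqnn _).
have -> : a + N.+1%:R * ((b - a) / N.+1%:R) = b.
  by rewrite mulrCA divff ?mulr1 ?pnatr_eq0// addrC subrK.
rewrite mulrAC -/K => HK.
rewrite -lerBlDl (le_trans HK)// ler_pdivrMr ?ltr0n// mulrC -ler_pdivrMr//.
by rewrite (le_trans (ltW NK))// ler_nat.
Qed.

Section demand.
Context (R : realType) (q : R -> R).

(* Expected profit from posting the price [x] when selling costs [c]. *)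
Definition profit (c x : R) : R := (x - c) * q x.

(** [demand_integrable] is the form in which integrability of the value is used for pricing: it
    bounds all profits and makes the maximal profit vanish as the cost grows. [demand_surj] omits 0
    and 1, which [q] need not attain. *)
Record demand_axioms : Prop := DemandAxioms {
  demand_nonincreasing : forall x y, x <= y -> q y <= q x ;
  demand_continuous : continuous q ;
  demand_ge0 : forall x, 0 <= q x ;
  demand_le1 : forall x, q x <= 1 ;
  demand_surj : forall u, 0 < u < 1 -> exists x, q x = u ;
  demand_vanishing : forall e, 0 < e -> exists x0, forall x, x0 <= x -> q x <= e ;
  demand_integrable : forall e, 0 < e ->
    exists2 c0, 0 <= c0 & forall c, c0 <= c -> forall x, profit c x <= e }.

Context (Dq : demand_axioms).

Lemma profit_continuous c : continuous (profit c).
Proof.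
move=> x; apply: cvgM; last exact: demand_continuous.
by apply: cvgB; [exact: cvg_id|exact: cvg_cst].
Qed.

Lemma profit_le_cost c c' x : c <= c' -> profit c' x <= profit c x.
Proof. by move=> cc; rewrite ler_wpM2r ?(demand_ge0 Dq)// lerB. Qed.

Lemma profit_costE c c' x : profit c x = profit c' x + (c' - c) * q x.
Proof. by rewrite -mulrDl addrA subrK. Qed.

(** At a large cost [c0] all profits are below [e / 2]. Returning to the cost [c] adds
    [(c0 - c) * q x], which is small at high prices. *)
Lemma profit_vanishing c e : 0 < e ->
  exists x0, forall x, x0 <= x -> profit c x <= e.
Proof.
move=> e0; have e20 : 0 < e / 2 by lra.
have [c0 c00 Hc0] := demand_integrable Dq e20.
have k0 : 0 < `|c0 - c| + 1 by rewrite ltr_wpDl.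
have [x0 Hx0] := demand_vanishing Dq (divr_gt0 e20 k0).
exists x0 => x /Hx0 qx; rewrite (profit_costE _ c0).
have := Hc0 _ (lexx _) x; rewrite ler_pdivlMr// in qx.
have := demand_ge0 Dq x; have := ler_norm (c0 - c); nra.
Qed.

Lemma profit_bounded c : exists M, forall x, profit c x <= M.
Proof.
have [c0 c00 Hc0] := demand_integrable Dq (@ltr01 R).
exists (1 + `|c0 - c|) => x; rewrite (profit_costE _ c0).
have := Hc0 _ (lexx _) x; have := demand_ge0 Dq x; have := demand_le1 Dq x.
have := ler_norm (c0 - c); have := normr_ge0 (c0 - c); nra.
Qed.

Definition max_profit c := sup (range (profit c)).

Lemma has_sup_profit c : has_sup (range (profit c)).
Proof.
split; first by exists (profit c 0), 0.
by have [M HM] := profit_bounded c; exists M => _ [x _ <-].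
Qed.

Lemma le_max_profit c x : profit c x <= max_profit c.
Proof. by apply: ub_le_sup; [exact: (has_sup_profit c).2|exists x]. Qed.

Lemma max_profit_le c M : (forall x, profit c x <= M) -> max_profit c <= M.
Proof. by move=> HM; apply: sup_le_ub; [exists (profit c 0), 0|move=> _ [x _ <-]]. Qed.

Lemma max_profit_attained c x :
  (forall y, profit c y <= profit c x) -> max_profit c = profit c x.
Proof. by move=> Hx; apply/le_anti; rewrite le_max_profit max_profit_le. Qed.

Lemma max_profit_ge0 c : 0 <= max_profit c.
Proof.
rewrite (le_trans _ (le_max_profit c c))//.
by rewrite /profit subrr mul0r.
Qed.

Lemma max_profit_vanishing e : 0 < e ->
  exists2 c0, 0 <= c0 & forall c, c0 <= c -> max_profit c <= e.
Proof.
move=> /(demand_integrable Dq)[c0 c00 Hc0]; exists c0 => // c cc.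
by apply: max_profit_le; exact: Hc0.
Qed.

(* The thresholds of [phi] are optimal posted prices for every cost. *)
Definition optimal_pricing (phi : R -> \bar R) := forall c,
  (forall p, (forall s, s < p -> (phi s < c%:E)%E) ->
     (forall s, p < s -> (c%:E <= phi s)%E) ->
     max_profit c = profit c p) /\
  ((forall s, (phi s < c%:E)%E) -> max_profit c = 0).

End demand.

(** * Ironing *)

Section ironing.
Context (R : realType) (q : R -> R) (Dq : demand_axioms q).

Definition affine_majorant (a b : R) := forall x, x * q x <= a + b * q x.

(** Counterpart of [ironed_revenue_curve] whose majorants are tested at prices instead of
    quantities, which keeps the quantile function out of this section. *)
Definition ironed_curve (u : R) : R :=
  inf [set y | exists a b : R, y = a + b * u /\ affine_majorant a b].

Definition ironed_slope (x : R) : \bar R :=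
  ereal_sup [set ((ironed_curve u - ironed_curve (q x)) / (u - q x))%:E
            | u in [set u | q x < u < 1]].

Let B := ironed_curve.

(* Otherwise the infimum defining [ironed_curve u] is a junk value. *)
Let bounded_at (u : R) := exists m, forall a b, affine_majorant a b -> m <= a + b * u.

(** This is the conjugacy between revenue curve and maximal profit: the intercepts of the majorants
    of slope [c] are the upper bounds of the profits at cost [c]. *)
Lemma affine_majorantP (c s : R) :
  (forall x, profit q c x <= s) <-> affine_majorant s c.
Proof.
by split=> H x; have := H x; rewrite /profit mulrBl lerBlDr.
Qed.

(** At a high nonnegative price the revenue is nonnegative while [b * q x] is negligible. *)
Lemma affine_majorant_ge0 a b : affine_majorant a b -> 0 <= a.
Proof.
move=> ab; apply/ler_addgt0Pr => e e0.
have k0 : 0 < `|b| + 1 by rewrite ltr_wpDl.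
have [x0 Hx0] := demand_vanishing Dq (divr_gt0 e0 k0).
pose x := Num.max x0 0; have := Hx0 x; rewrite le_max lexx => /(_ isT).
rewrite ler_pdivlMr//; have := ab x; have := demand_ge0 Dq x.
have : 0 <= x by rewrite le_max lexx orbT.
have := ler_norm b; nra.
Qed.

Let bounded0 : bounded_at 0.
Proof. by exists 0 => a b /affine_majorant_ge0; rewrite mulr0 addr0. Qed.

Let boundedq x : bounded_at (q x).
Proof. by exists (x * q x) => a b; exact. Qed.

(** An attained quantity is bounded by its own revenue; 0, which may not be attained, has been
    treated apart. The quantity 1 has no such substitute. *)
Let bounded01 u : 0 <= u < 1 -> bounded_at u.
Proof.
move=> /andP[]; rewrite le_eqVlt => /predU1P[<- //|u0 u1].
by have [|x <-//] := demand_surj Dq (u := u); rewrite u0.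
Qed.

Let B_le u a b : bounded_at u -> affine_majorant a b -> B u <= a + b * u.
Proof.
by move=> [m Hm] ab; apply: ge_inf; [exists m => _ [a' [b' [-> /Hm]]]|exists a, b].
Qed.

Let B_ge u m : (forall a b, affine_majorant a b -> m <= a + b * u) -> m <= B u.
Proof.
move=> Hm; apply: lb_le_inf => [|_ [a [b [-> /Hm//]]]].
have [M HM] := profit_bounded Dq 0.
by exists (M + 0 * u), M, 0; split => //; apply/affine_majorantP.
Qed.

Let B_geq x : x * q x <= B (q x). Proof. by apply: B_ge => a b; exact. Qed.

Let B_concave u v w : bounded_at u -> bounded_at w -> u <= v -> v <= w ->
  (w - v) * B u + (v - u) * B w <= (w - u) * B v.
Proof.
move=> bu bw uv vw; have [uw|uw] := leP w u.
  have uv' : u = v by apply/le_anti; rewrite uv (le_trans vw uw).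
  have vw' : v = w by apply/le_anti; rewrite vw -uv' uw.
  by rewrite -vw' -uv' !subrr !mul0r addr0.
rewrite -ler_pdivrMl ?subr_gt0//.
apply: B_ge => a b ab; rewrite ler_pdivrMl ?subr_gt0//.
have := B_le bu ab; have := B_le bw ab; nra.
Qed.

(** A higher price means a smaller quantity, and by concavity a chord to the same right end [u] is
    steeper when it starts further left. *)
Lemma ironed_slope_nondecreasing : {homo ironed_slope : x y / x <= y >-> (x <= y)%E}.
Proof.
move=> x y xy; apply: ge_ereal_sup => _ [u /andP[xu u1] <-].
have yx := demand_nonincreasing Dq xy.
have yu := le_lt_trans yx xu.
apply: ereal_sup_ge.
exists ((B u - B (q y)) / (u - q y))%:E; first by exists u => //; rewrite /= yu u1.
have bu : bounded_at u.
  by apply: bounded01; rewrite u1 (le_trans (demand_ge0 Dq x) (ltW xu)).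
rewrite lee_fin ler_pdivrMr ?subr_gt0// mulrAC ler_pdivlMr ?subr_gt0//.
have := B_concave (boundedq y) bu yx (ltW xu); rewrite -/B; lra.
Qed.

Let slope_ge c x e : (c%:E <= ironed_slope x)%E -> 0 < e ->
  exists2 u, q x < u < 1 & (c - e) * (u - q x) < B u - B (q x).
Proof.
move=> cx e0.
have /ereal_sup_gt[_ [u /andP[xu u1] <-]] : ((c - e)%:E < ironed_slope x)%E.
  by rewrite (lt_le_trans _ cx)// lte_fin ltrBlDr ltrDl.
by rewrite lte_fin ltr_pdivlMr ?subr_gt0// => ?; exists u => //; rewrite xu.
Qed.

Let slope_lt c x : (ironed_slope x < c%:E)%E ->
  exists2 e, 0 < e & forall u, q x < u < 1 ->
    B u - B (q x) <= (c - e) * (u - q x).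
Proof.
move=> cx.
have [r xr rc] : exists2 r, (ironed_slope x <= r%:E)%E & r < c.
  move: cx; case: (ironed_slope x) => [r|//|_]; first by rewrite lte_fin; exists r.
  (* A slope [-oo] is the supremum of an empty set of chords ([q x = 1]), so any number below [c]
     serves. *)
  by exists (c - 1); [rewrite leNye|rewrite ltrBlDr ltrDl].
exists (c - r); first by rewrite subr_gt0.
move=> u /andP[xu u1]; rewrite subKr -ler_pdivrMr ?subr_gt0// -lee_fin.
by apply: le_trans xr; apply: ereal_sup_ubound; exists u => //; rewrite /= xu.
Qed.

Let slope_ge_lt1 c x : (c%:E <= ironed_slope x)%E -> q x < 1.
Proof. by move=> /slope_ge/(_ ltr01)[u /andP[xu u1] _]; exact: lt_trans u1. Qed.

(* By concavity the ironed curve lies below its supporting line of slope [c]. *)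
Let slope_ge_left c x u : (c%:E <= ironed_slope x)%E -> 0 <= u -> u <= q x ->
  B u <= B (q x) + c * (u - q x).
Proof.
move=> cx u0; rewrite le_eqVlt => /predU1P[->|ux].
  by rewrite subrr mulr0 addr0.
have bu : bounded_at u by apply: bounded01; rewrite u0 (lt_trans ux)// (slope_ge_lt1 cx).
apply/ler_addgt0Pr => e e0.
have ux0 : 0 < q x - u by rewrite subr_gt0.
have [w /andP[xw w1]] := slope_ge cx (divr_gt0 e0 ux0).
have bw : bounded_at w.
  by apply: bounded01; rewrite w1 (le_trans (demand_ge0 Dq x) (ltW xw)).
have := B_concave bu bw (ltW ux) (ltW xw).
set d := e / _; have de : d * (q x - u) = e by rewrite /d divfK// gt_eqF.
move=> cc ss.
have h : (w - q x) * (B u - B (q x) - c * (u - q x)) <= (w - q x) * (d * (q x - u)).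
  have : (q x - u) * ((c - d) * (w - q x)) <= (q x - u) * (B w - B (q x)).
    by rewrite ler_wpM2l// ltW.
  lra.
rewrite ler_pM2l ?subr_gt0// in h; lra.
Qed.

(* If the profit stayed below [m] on the left of [x], tilting the majorant of
   slope [c] around [q x] would lower the slope at [x] below [c]. *)
Let profit_le_left c x m : (c%:E <= ironed_slope x)%E ->
  (forall y, y <= x -> profit q c y <= m) -> forall y, profit q c y <= m.
Proof.
move=> cx Hm y; rewrite leNgt; apply/negP => my.
set s := max_profit q c.
have ms : m < s by rewrite (lt_le_trans my)// le_max_profit.
have x1 := slope_ge_lt1 cx.
(* At [q z] this line is [s + c * q z + (s - m) * (q x - q z)]. To the right of [x] the last term is
   nonnegative; to the left it is at least [m - s], since quantities differ by at most 1, and there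
   profits are at most [m]. *)
have tilted : affine_majorant (s + (s - m) * q x) (c - (s - m)).
  move=> z; have [zx|/ltW xz] := leP z x.
    have := Hm _ zx; rewrite /profit.
    have := demand_nonincreasing Dq zx; have := demand_le1 Dq z; have := demand_ge0 Dq x.
    nra.
  have := le_max_profit Dq c z; rewrite -/s /profit.
  have := demand_nonincreasing Dq xz; nra.
(* Profits close to [s] occur only to the right of [x], where the supporting line of slope [c]
   through the curve at [q x] bounds them. *)
have sB : s <= B (q x) - c * q x.
  rewrite leNgt; apply/negP => Bs.
  have : Num.max m (B (q x) - c * q x) < s by rewrite gt_max ms.
  move=> /sup_gt -/(_ (has_sup_profit Dq c).1)[_ [z _ <-]].
  rewrite gt_max => /andP[mz Bz].
  have /ltW xz : x < z by rewrite ltNge; apply: contraTN mz => /Hm; rewrite leNgt.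
  have := slope_ge_left cx (demand_ge0 Dq z) (demand_nonincreasing Dq xz).
  have := B_geq z; move: Bz; rewrite /profit; lra.
have e0 : 0 < (s - m) / 2 by lra.
have [u /andP[xu u1] Hu] := slope_ge cx e0.
have bu : bounded_at u.
  by apply: bounded01; rewrite u1 (le_trans (demand_ge0 Dq x) (ltW xu)).
have := B_le bu tilted; nra.
Qed.

(** Moving left from [x], the ironed curve falls behind a line of slope [c] by [e] per unit of
    quantity. So profits are far below [s] when the quantity is far from [q x]; when it is close,
    they are hardly above the profit at [x], which is below [s] by assumption. *)
Let profit_lt_left c x s : (ironed_slope x < c%:E)%E ->
  (forall y, profit q c y <= s) -> profit q c x < s ->
  exists2 m, m < s & forall y, y <= x -> profit q c y <= m.
Proof.
move=> cx Hs xs; have [x1|x1] := leP 1 (q x).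
  exists (profit q c x) => // y yx.
  have qy : q y = 1.
    by apply/le_anti; rewrite (demand_le1 Dq)// (le_trans x1)// demand_nonincreasing.
  have qx : q x = 1 by apply/le_anti; rewrite x1 demand_le1.
  by rewrite /profit qx qy !mulr1 lerD2r.
have [e e0 He] := slope_lt cx.
have sc : affine_majorant s c by apply/affine_majorantP.
have Bx := B_le (boundedq x) sc.
have left_bound y : y <= x -> profit q c y <= s - e * (q y - q x).
  move=> yx; have xy := demand_nonincreasing Dq yx.
  have := B_geq y; rewrite /profit.
  suff : B (q y) - B (q x) <= (c - e) * (q y - q x) by lra.
  move: xy; rewrite le_eqVlt => /predU1P[->|xy]; first by rewrite !subrr mulr0.
  have := demand_le1 Dq y; rewrite le_eqVlt => /predU1P[y1|y1]; last first.
    by apply: He; rewrite xy.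
  pose v := (q x + q y) / 2.
  have xv : q x < v by rewrite /v; lra.
  have vy : v < q y by rewrite /v; lra.
  have := B_concave (boundedq x) (boundedq y) (ltW xv) (ltW vy).
  have : q x < v < 1 by rewrite xv -y1.
  move=> /He hv cc; have xv' : 0 < v - q x by rewrite subr_gt0.
  rewrite -(ler_pM2l xv'); have yx' : 0 <= q y - q x by lra.
  have := ler_wpM2l yx' hv; lra.
pose k := `|x - c|; pose d := s - profit q c x.
have d0 : 0 < d by rewrite subr_gt0.
have k0 : 0 <= k := normr_ge0 _.
have ek : 0 < e + k by rewrite ltr_wpDr.
(* The quantity change [h = d / (e + k)] balances the two bounds: [s - e * h = (s - d) + k * h]. *)
exists (s - e * (d / (e + k))).
  by rewrite ltrBlDr ltrDl mulr_gt0// divr_gt0.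
move=> y yx; have := left_bound y yx; set h := d / (e + k).
have hd : h * (e + k) = d by rewrite /h divfK// gt_eqF.
have [hy|hy] := leP h (q y - q x); first by have := ler_wpM2l (ltW e0) hy; lra.
have : profit q c y <= (s - d) + k * (q y - q x).
  rewrite /d subKr {1}/profit /profit.
  have := demand_nonincreasing Dq yx; have := demand_ge0 Dq y.
  by have := ler_norm (x - c); rewrite -/k; nra.
have := ler_wpM2l k0 (ltW hy); lra.
Qed.

(** If the threshold [p] were not optimal, profits would stay away from the maximum to its left by
    [profit_lt_left], around it by continuity, and then everywhere by [profit_le_left] at a point
    just right of [p]. Without a threshold, high prices earn little and [profit_lt_left] covers all
    others. *)
Lemma ironed_slope_optimal : optimal_pricing q ironed_slope.
Proof.
move=> c; split=> [p below above|below]; apply/eqP; rewrite eq_le.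
  rewrite le_max_profit// andbT leNgt; apply/negP => ps.
  set s := max_profit q c in ps *; set e := (s - profit q c p) / 2.
  have e0 : 0 < e by rewrite divr_gt0// subr_gt0.
  have : \forall z \near p, profit q c z < s - e.
    have := @profit_continuous _ _ Dq c p; move=> /cvgrPdist_lt/(_ e e0).
    apply: filterS => z; rewrite ltr_norml => /andP[+ _].
    by rewrite /e; lra.
  move=> /nbhs_ballP[r /= r0 Hr].
  have near z : `|p - z| < r -> profit q c z < s - e by move=> pz; exact: Hr.
  pose x := p - r / 2; pose y := p + r / 2.
  have xp : x < p by rewrite /x; lra.
  have py : p < y by rewrite /y; lra.
  have xs : profit q c x < s.
    by have := near x; rewrite /x subKr gtr0_norm; lra.
  have [m ms Hm] := profit_lt_left (below _ xp) (le_max_profit Dq c) xs.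
  have : forall z, z <= y -> profit q c z <= Num.max m (s - e).
    move=> z zy; rewrite le_max; have [zx|/ltW xz] := leP z x.
      by rewrite Hm.
    by rewrite orbC ltW// near// ltr_norml; move: zy xz; rewrite /x /y; lra.
  move=> /(profit_le_left (above _ py))/(max_profit_le (q := q)).
  by rewrite -/s le_max leNgt ms /= leNgt ltrBlDr ltrDl e0.
rewrite max_profit_ge0// andbT leNgt; apply/negP => s0.
set s := max_profit q c in s0 *.
have s20 : 0 < s / 2 by lra.
have [x Hx] := profit_vanishing Dq c s20.
have xs : profit q c x < s by have := Hx _ (lexx x); lra.
have [m ms Hm] := profit_lt_left (below x) (le_max_profit Dq c) xs.
have : s <= Num.max m (s / 2).
  apply: max_profit_le => z; rewrite le_max; have [zx|/ltW xz] := leP z x.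
    by rewrite Hm.
  by rewrite orbC Hx.
by rewrite le_max leNgt ms /= leNgt; lra.
Qed.

(** At cost 0, prices up to [x] lose at least [- x * q x], whereas the price 0 earns 0. If [q x > 0]
    this contradicts [profit_le_left]; the case [q x = 0] is treated directly. *)
Lemma ironed_slope_lt0 x : x < 0 -> (ironed_slope x < 0)%E.
Proof.
move=> x0; rewrite ltNge; apply/negP => sx.
have := demand_ge0 Dq x; rewrite le_eqVlt => /predU1P[qx|qx].
  have le1 : (x%:E <= ironed_slope x)%E by rewrite (le_trans _ sx)// lee_fin ltW.
  (* All sales now occur below the negative price [x], so the line of slope [x] through the origin
     majorizes the curve and bounds its slope at 0. *)
  have maj : affine_majorant 0 x.
    move=> y; rewrite add0r; have [yx|/ltW xy] := leP y x.
      by rewrite ler_wpM2r// (demand_ge0 Dq).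
    have -> : q y = 0.
      by apply/le_anti; rewrite (demand_ge0 Dq) andbT qx demand_nonincreasing.
    by rewrite !mulr0.
  have e0 : 0 < - x / 2 by lra.
  have [u /andP[xu u1]] := slope_ge sx e0.
  rewrite -qx subr0 sub0r.
  have bu : bounded_at u by apply: bounded01; rewrite u1 qx ltW.
  have := B_le bu maj; have := B_geq x; rewrite -qx mulr0 add0r.
  have u0 : 0 < u by rewrite qx.
  have := mulr_gt0 u0 e0; rewrite -/B; move: (B u) (B 0) => b z; lra.
have left_le y : y <= x -> profit q 0 y <= x * q x.
  by move=> yx; rewrite /profit subr0; have := demand_nonincreasing Dq yx; nra.
have := profit_le_left sx left_le 0; rewrite /profit subr0 mul0r; nra.
Qed.

End ironing.

(** * Demand of one builder *)

Section agent.
Context (d : measure_display) (Omega : measurableType d) (R : realType)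
  (P : probability Omega R) (X : {RV P >-> R}) (f : R -> R).

Definition sale_prob (x : R) : R := 1 - dist_fun X x.

Lemma sale_prob_ccdf x : (sale_prob x)%:E = ccdf X x.
Proof. by rewrite /sale_prob /dist_fun EFinB fineK ?fin_num_measure// -ccdf_1_cdf. Qed.

Lemma sale_probE x : (sale_prob x)%:E = P (X @^-1` `]x, +oo[).
Proof. exact: sale_prob_ccdf. Qed.

Lemma sale_prob_nonincreasing x y : x <= y -> sale_prob y <= sale_prob x.
Proof.
move=> xy; rewrite lerB// /dist_fun fine_le ?fin_num_measure//.
exact: cdf_nondecreasing.
Qed.

Lemma sale_prob_ge0 x : 0 <= sale_prob x.
Proof. by rewrite -lee_fin sale_probE. Qed.

Lemma sale_prob_le1 x : sale_prob x <= 1.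
Proof. by rewrite -lee_fin sale_probE probability_le1//; exact: measurable_funPTI. Qed.

Lemma sale_prob_eventually_small e : 0 < e ->
  exists x0, forall x, x0 <= x -> sale_prob x <= e.
Proof.
move=> e0; have := cvg_ccdfy0 X; rewrite -/(0%R%:E) => /fine_cvgP[_].
move=> /cvgrPdist_le/(_ _ e0)[x0 [_ Hx0]]; exists (x0 + 1) => x x0x.
have := Hx0 x; rewrite (lt_le_trans _ x0x) ?ltrDl// sub0r normrN => /(_ isT).
by move=> /(le_trans (ler_norm _)); rewrite /= -sale_prob_ccdf.
Qed.

Lemma sale_prob_eventually_large e : 0 < e ->
  exists x0, forall x, x <= x0 -> 1 - e <= sale_prob x.
Proof.
move=> e0; have := cvg_cdfNy0 X; rewrite -/(0%R%:E) => /fine_cvgP[_].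
move=> /cvgrPdist_le/(_ _ e0)[x0 [_ Hx0]]; exists (x0 - 1) => x x0x.
have := Hx0 x; rewrite (le_lt_trans x0x) ?ltrBlDr ?ltrDl// sub0r normrN => /(_ isT).
by move=> /(le_trans (ler_norm _)) H; rewrite lerB.
Qed.

Context (iX : P.-integrable [set: Omega] (EFin \o X)).

Let excess (c : R) (w : Omega) : R := Num.max (X w - c) 0.

Let measurable_excess (c : R) : measurable_fun [set: Omega] (EFin \o excess c).
Proof.
apply/measurable_EFinP; apply: measurable_maxr => //.
by apply: measurable_funB => //; exact: measurable_cst.
Qed.

Let profit_le_excess c x : c <= x ->
  ((profit sale_prob c x)%:E <= \int[P]_w (excess c w)%:E)%E.
Proof.
move=> cx; set A := X @^-1` `]x, +oo[.
have mA : measurable A by exact: measurable_funPTI.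
rewrite /profit EFinM sale_probE -/A.
rewrite -(integral_cst P mA).
rewrite (le_trans (y := (\int[P]_(w in A) (excess c w)%:E)%E))//.
  apply: ge0_le_integral => //.
  - by move=> w _; rewrite lee_fin subr_ge0.
  - exact: measurable_funTS (measurable_excess c).
  - move=> w; rewrite /A /= in_itv/= andbT => xw.
    by rewrite lee_fin le_max lerD2r (ltW xw).
apply: ge0_subset_integral => //; first exact: measurable_excess.
by move=> w _; rewrite lee_fin le_max lexx orbT.
Qed.

Let excess_vanishing e : 0 < e ->
  exists2 n : nat, True & (\int[P]_w (excess n%:R w)%:E <= e%:E)%E.
Proof.
move=> e0.
have [] := @dominated_convergence _ _ _ P _ (@measurableT _ _)
  (fun n w => (excess n%:R w)%:E) (cst 0%E) (fun w => `|(X w)%:E|)%E.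
- by move=> n; exact: measurable_excess.
- exact: measurable_cst.
- apply: aeW => w _; apply: cvg_near_cst; exists (Num.bound `|X w|) => // n /= wn.
  congr EFin; apply/max_idPr; rewrite subr_le0 (le_trans (ler_norm _))//.
  by rewrite (le_trans (ltW (archi_boundP (normr_ge0 _))))// ler_nat.
- exact: (integrable_abse iX).
- apply: aeW => w n _ /=; rewrite lee_fin ger0_norm ?le_max ?lexx ?orbT//.
  rewrite ge_max normr_ge0 andbT lerBlDr (le_trans (ler_norm _))// lerDl//.
move=> _ _; rewrite integral_cst// mul0e => /fine_cvgP[[N _ HN]].
move=> /cvgrPdist_le/(_ _ e0)[M _ HM]; exists (maxn N M) => //.
have := HN (maxn N M) (leq_maxl _ _); have := HM (maxn N M) (leq_maxr _ _).
rewrite /= sub0r normrN => H finI; rewrite -(fineK finI) lee_fin.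
exact: le_trans (ler_norm _) H.
Qed.

(** Profits at cost [c] are at most the mean of the positive part of [X - c], which tends to 0 by
    dominated convergence. *)
Lemma sale_prob_integrable e : 0 < e ->
  exists2 c0, 0 <= c0 & forall c, c0 <= c -> forall x, profit sale_prob c x <= e.
Proof.
move=> e0; have [n _ Hn] := excess_vanishing e0; exists n%:R => // c nc x.
have [cx|xc] := leP c x; last first.
  by rewrite (le_trans _ (ltW e0))// mulr_le0_ge0 ?sale_prob_ge0// subr_le0 ltW.
rewrite -lee_fin (le_trans (profit_le_excess cx))// (le_trans _ Hn)//.
apply: ge0_le_integral => //; try exact: measurable_excess.
  by move=> w _; rewrite lee_fin le_max lexx orbT.
move=> w _; rewrite lee_fin ge_max !le_max lexx orbT andbT.
by rewrite lerB.
Qed.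

Context (Xf : has_density X f).

Lemma density_atomless x : P (X @^-1` [set x]) = 0%E.
Proof.
have [mf f0 Pf] := Xf; rewrite Pf// null_set_integral//.
- exact: measurable_funTS (measurableT_comp _ _).
- exact: lebesgue_measure_set1.
Qed.

Lemma sale_prob_geE x : (sale_prob x)%:E = P (X @^-1` `[x, +oo[).
Proof.
rewrite sale_probE -(@setU1itv _ _ _ x false)// preimage_setU measureU//.
- by rewrite [X in _ = (X + _)%E](density_atomless x) add0e.
- exact: measurable_funPTI.
- by rewrite -subset0 => w [/= ->]; rewrite in_itv/= ltxx.
Qed.

Lemma sale_probB x y : x <= y ->
  (sale_prob x - sale_prob y)%:E = P (X @^-1` `]x, y[).
Proof.
rewrite le_eqVlt => /predU1P[<-|xy].
  by rewrite subrr set_itvoo0 ?preimage_set0 ?measure0.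
rewrite EFinB sale_probE sale_prob_geE.
have -> : X @^-1` `]x, +oo[ = X @^-1` `]x, y[ `|` X @^-1` `[y, +oo[.
  by rewrite -preimage_setU -itv_bndbnd_setU// bnd_simp ltW.
rewrite measureU//; try exact: measurable_funPTI.
  by rewrite addeK// fin_num_measure//; exact: measurable_funPTI.
rewrite -subset0 => w []; rewrite /= !in_itv/= andbT => /andP[_ wy].
by rewrite leNgt wy.
Qed.

(** Left continuity is where the absence of atoms matters: the events [X > x - 1/(n+1)] decrease to
    [X >= x], not to [X > x]. *)
Lemma sale_prob_left x e : 0 < e ->
  exists2 h, 0 < h & sale_prob (x - h) <= sale_prob x + e.
Proof.
move=> e0.
pose F n := X @^-1` `]x - n.+1%:R^-1, +oo[.
have : P (F n) @[n --> \oo] --> P (\bigcap_n F n).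
  apply: nonincreasing_cvg_mu.
  - by rewrite ltey_eq fin_num_measure//; exact: measurable_funPTI.
  - by move=> n; exact: measurable_funPTI.
  - by apply: bigcap_measurable => // n _; exact: measurable_funPTI.
  - move=> m n mn; apply/subsetPset; apply: preimage_subset; apply: subset_itvr.
    by rewrite bnd_simp lerB// lef_pV2 ?posrE// ler_nat.
rewrite -preimage_bigcap -itvcyEbigcap -sale_prob_geE => /fine_cvgP[_].
move=> /cvgrPdist_le/(_ _ e0)[N _ /(_ N (leqnn N))]/=.
rewrite -sale_probE/= distrC => /(le_trans (ler_norm _)); rewrite lerBlDl => H.
by exists N.+1%:R^-1 => //; rewrite invr_gt0.
Qed.

Lemma sale_prob_right x e : 0 < e ->
  exists2 h, 0 < h & sale_prob x - e <= sale_prob (x + h).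
Proof.
move=> e0; have := @ccdf_right_continuous _ _ _ P X x.
rewrite -sale_prob_ccdf => /fine_cvgP[_].
move=> /cvgrPdist_le/(_ _ e0) -[h /= h0 Hh].
have h20 : 0 < h / 2 by rewrite divr_gt0.
exists (h / 2) => //; have := Hh (x + h / 2).
rewrite /= opprD addrA subrr sub0r normrN gtr0_norm// ltrDl h20.
have -> : h / 2 < h by rewrite ltr_pdivrMr// ltr_pMr// ltr1n.
rewrite -sale_prob_ccdf/= => /(_ isT isT).
by move=> /(le_trans (ler_norm _)); lra.
Qed.

Lemma sale_prob_continuous : continuous sale_prob.
Proof.
move=> x; apply/cvgrPdist_le => e e0.
have [h h0 Hh] := sale_prob_left x e0; have [k k0 Hk] := sale_prob_right x e0.
have hk : 0 < Num.min h k by rewrite lt_min h0.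
apply: filterS (nbhsx_ballx x _ hk) => z; rewrite /ball/= lt_min !ltr_norml.
move=> /andP[/andP[hz zh] /andP[kz zk]].
rewrite ler_norml; apply/andP; split.
  have : x - h <= z by lra.
  by move=> /sale_prob_nonincreasing; lra.
have : z <= x + k by lra.
by move=> /sale_prob_nonincreasing; lra.
Qed.

Lemma sale_prob_surj u : 0 < u < 1 -> exists x, sale_prob x = u.
Proof.
move=> /andP[u0 u1].
have [b Hb] := sale_prob_eventually_small u0.
have u10 : 0 < 1 - u by rewrite subr_gt0.
have [a Ha] := sale_prob_eventually_large u10.
have ab : Num.min a b <= b by rewrite ge_min lexx orbT.
have [||x _ <-] := @IVT _ sale_prob _ _ u ab; last by exists x.
- by apply: continuous_subspaceT; exact: sale_prob_continuous.
- have := Ha (Num.min a b); rewrite ge_min lexx subKr => /(_ isT) ua.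
  have := Hb _ (lexx b) => bu.
  by rewrite ge_min bu orbT le_max ua.
Qed.

Lemma sale_prob_demand : demand_axioms sale_prob.
Proof.
split.
- exact: sale_prob_nonincreasing.
- exact: sale_prob_continuous.
- exact: sale_prob_ge0.
- exact: sale_prob_le1.
- exact: sale_prob_surj.
- exact: sale_prob_eventually_small.
- exact: sale_prob_integrable.
Qed.

End agent.

(** * Virtual values *)

Section virtual_values.
Context (d : measure_display) (Omega : measurableType d) (R : realType)
  (P : probability Omega R) (X : {RV P >-> R}) (f : R -> R)
  (iX : P.-integrable [set: Omega] (EFin \o X)) (Xf : has_density X f).

Let q := sale_prob X.
Let Dq : demand_axioms q := sale_prob_demand iX Xf.

Let le_quantile u x : 0 < u -> u < q x -> x <= quantile X (1 - u).
Proof.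
move=> u0 uqx; apply: lb_le_inf.
  have [b Hb] := demand_vanishing Dq u0; exists b.
  by have := Hb _ (lexx b); rewrite /q /sale_prob /=; lra.
move=> y /=; apply: contraPle => /ltW/(demand_nonincreasing Dq).
by move: uqx; rewrite /q /sale_prob; lra.
Qed.

(** The two sides differ on flat pieces of the demand: [revenue_curve] takes the lowest price
    selling a given quantity, [affine_majorant] tests all of them. The higher prices are recovered
    from quantities slightly below [q x], whose quantile is at least [x]. *)
Let affine_majorant_revenue a b :
  affine_majorant q a b <->
  forall u, 0 <= u < 1 -> revenue_curve X u <= a + b * u.
Proof.
split=> [ab u|ab x].
  rewrite le_eqVlt => /andP[/predU1P[<- _|u0 u1]].
    by rewrite /revenue_curve mul0r mulr0 addr0 (affine_majorant_ge0 Dq ab).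
  have u01 : 0 < u < 1 by rewrite u0.
  have [x qx] := demand_surj Dq u01.
  have zx : quantile X (1 - u) <= x.
    apply: ge_inf; last by move: qx; rewrite /q /sale_prob /=; lra.
    have e0 : 0 < (1 - u) / 2 by lra.
    have [z Hz] := sale_prob_eventually_large X e0; exists z => y /= uy.
    rewrite leNgt; apply/negP => /ltW/Hz; move: uy.
    by rewrite /sale_prob; lra.
  rewrite /revenue_curve (le_trans (ler_wpM2l (ltW u0) zx))// -qx mulrC.
  exact: ab.
have := demand_ge0 Dq x; rewrite le_eqVlt => /predU1P[qx|qx0].
  by have := ab 0; rewrite -qx /revenue_curve mul0r !mulr0 lexx ltr01 => ->.
have near u : 0 < u < q x -> u * x <= a + b * u.
  move=> /andP[u0 ux]; have := ab u.
  rewrite (ltW u0) (lt_le_trans ux (demand_le1 Dq x)) => /(_ isT); apply: le_trans.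
  by rewrite /revenue_curve ler_wpM2l ?le_quantile// ltW.
apply/ler_addgt0Pr => e e0.
have k0 : 0 < `|x - b| + 1 by rewrite ltr_wpDl.
(* Selling [q x - t] instead of [q x] changes the inequality by [t * (x - b)], kept below [e]; the
   second bound keeps the quantity positive. *)
pose t := Num.min (e / (`|x - b| + 1)) (q x / 2).
have t0 : 0 < t by rewrite lt_min !divr_gt0.
have te : t * (`|x - b| + 1) <= e by rewrite -ler_pdivlMr// ge_min lexx.
have tq : t <= q x / 2 by rewrite ge_min lexx orbT.
have : 0 < q x - t < q x by apply/andP; split; lra.
move=> /near; have := ler_norm (x - b); nra.
Qed.

Lemma ironed_revenue_curveE : ironed_revenue_curve X = ironed_curve q.
Proof.
apply/funext => u; congr inf; apply/seteqP; split=> y [a [b [-> ab]]];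
  by exists a, b; split => //; apply/affine_majorant_revenue.
Qed.

Lemma ironed_virtual_valueE : ironed_virtual_value X = ironed_slope q.
Proof.
by apply/funext => x; rewrite /ironed_virtual_value ironed_revenue_curveE.
Qed.

Let virtual_value_le x : (virtual_value X f x <= x%:E)%E.
Proof.
have [_ f0 _] := Xf; have := demand_ge0 Dq x.
rewrite /virtual_value -/(q x) inver; case: eqP => [_ qx|_ qx].
  by rewrite -[leRHS]adde0 leeD2l// oppe_le0 mule_ge0// ?leey ?lee_fin.
by rewrite -EFinM -EFinB lee_fin lerBlDr lerDl mulr_ge0// invr_ge0.
Qed.

(** Formally the derivative of the profit is [q x - (x - c) * f x]. This lemma and the next give its
    sign without dividing by [f x], which may be 0. *)
Let virtual_value_lt c x : (virtual_value X f x < c%:E)%E -> (x - c) * f x <= q x.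
Proof.
have [_ f0 _] := Xf; have := demand_ge0 Dq x.
rewrite /virtual_value -/(q x) inver; case: eqP => [-> qx _|/eqP fx qx].
  by rewrite mulr0.
have fx0 : 0 < f x by rewrite lt_neqAle eq_sym fx f0.
by rewrite -EFinM -EFinB lte_fin ltrBlDr -ltrBlDl ltr_pdivlMr// => /ltW.
Qed.

Let virtual_value_ge c x : 0 < q x -> (c%:E <= virtual_value X f x)%E ->
  q x <= (x - c) * f x.
Proof.
have [_ f0 _] := Xf; move=> qx.
rewrite /virtual_value -/(q x) inver; case: eqP => [->|/eqP fx].
  by rewrite gt0_muley ?lte_fin// addeNy leeNy_eq.
have fx0 : 0 < f x by rewrite lt_neqAle eq_sym fx f0.
by rewrite -EFinM -EFinB lee_fin lerBrDr -lerBrDl ler_pdivrMr.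
Qed.

Let sale_prob_density_le x y m : x <= y ->
  (forall z, x < z < y -> f z <= m) -> q x - q y <= m * (y - x).
Proof.
move=> xy Hm; have [mf f0 Pf] := Xf.
rewrite -lee_fin (sale_probB Xf)// Pf//.
apply: (@le_trans _ _ (\int[lebesgue_measure]_(z in `]x, y[) (cst m%:E z))%E).
  apply: ge0_le_integral => //.
  - by move=> z _; rewrite lee_fin.
  - exact: measurable_funTS (measurableT_comp _ _).
rewrite integral_cst//= lebesgue_measure_itv/= lte_fin.
case: ltP => [_|yx]; first by rewrite -EFinB -EFinM.
by rewrite mule0 lee_fin (@le_anti _ _ x y) ?xy// subrr mulr0.
Qed.

Let sale_prob_density_ge x y m : 0 <= m -> x <= y ->
  (forall z, x < z < y -> m <= f z) -> m * (y - x) <= q x - q y.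
Proof.
move=> m0 xy Hm; have [mf f0 Pf] := Xf.
rewrite -lee_fin (sale_probB Xf)// Pf//.
apply: (@le_trans _ _ (\int[lebesgue_measure]_(z in `]x, y[) (cst m%:E z))%E); last first.
  apply: ge0_le_integral => //.
  - exact: measurable_funTS (measurableT_comp _ _).
rewrite integral_cst//= lebesgue_measure_itv/= lte_fin.
case: ltP => [_|yx]; first by rewrite -EFinB -EFinM.
by rewrite mule0 lee_fin (@le_anti _ _ x y) ?xy// subrr mulr0.
Qed.

(** Between [x] and [y] the density is at most [q x / (x - c)], so at most [(y - x) * q x / (x - c)]
    of demand is lost. Having [q x] here instead of [q y] costs [(y - x) * (q x - q y)], exactly the
    error allowed by [le_of_increment_le]. *)
Let profit_increasing c a b : a <= b ->
  (forall z, a < z < b -> (virtual_value X f z < c%:E)%E) ->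
  profit q c a <= profit q c b.
Proof.
move=> ab low; rewrite -lerN2.
apply: (@le_of_increment_le _ (fun x => - profit q c x) (fun x => - q x)) => //.
move=> x y ax xy yb.
suff : (x - c) * (q x - q y) <= (y - x) * q x by rewrite /profit; lra.
have := demand_nonincreasing Dq xy; have := demand_ge0 Dq x.
have [xc|cx] := leP x c; first by nra.
have xc0 : 0 < x - c by rewrite subr_gt0.
move=> _ _; rewrite mulrC -ler_pdivlMr// -mulrA mulrC.
apply: sale_prob_density_le => // z /andP[xz zy].
have := virtual_value_lt (low z _); rewrite (le_lt_trans ax xz) (lt_le_trans zy yb).
move=> /(_ isT) h; rewrite ler_pdivlMr//.
have := demand_nonincreasing Dq (ltW xz); have [_ f0 _] := Xf; have := f0 z; nra.
Qed.

Let profit_decreasing c a b : a <= b ->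
  (forall z, a < z < b -> (c%:E <= virtual_value X f z)%E) ->
  profit q c b <= profit q c a.
Proof.
move=> ab high.
apply: (@le_of_increment_le _ (profit q c) (fun x => - q x)) => // x y ax xy yb.
suff : (y - x) * q y <= (y - c) * (q x - q y) by rewrite /profit; lra.
move: xy; rewrite le_eqVlt => /predU1P[->|xy]; first by rewrite !subrr mul0r mulr0.
(* A virtual value never exceeds the value, so an interior point is needed to get [c <= m < y]. *)
pose m := (x + y) / 2.
have xm : x < m by rewrite /m; lra.
have my : m < y by rewrite /m; lra.
have high' z : x < z < y -> (c%:E <= virtual_value X f z)%E.
  by move=> /andP[xz zy]; rewrite high// (le_lt_trans ax xz) (lt_le_trans zy yb).
have cm : c <= m.
  by rewrite -lee_fin (le_trans _ (virtual_value_le m))// high'// xm.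
have yc0 : 0 < y - c by lra.
have := demand_ge0 Dq y; rewrite le_eqVlt => /predU1P[<-|qy].
  by rewrite mulr0 subr0 mulr_ge0 ?(demand_ge0 Dq)// ltW.
rewrite [leRHS]mulrC -ler_pdivrMr// -mulrA mulrC.
apply: sale_prob_density_ge; first by rewrite divr_ge0// ltW.
  exact: ltW.
move=> z /andP[xz zy]; rewrite ler_pdivrMr//.
have qzy := demand_nonincreasing Dq (ltW zy).
have := virtual_value_ge (lt_le_trans qy qzy) (high' z _); rewrite xz zy.
by move=> /(_ isT); have [_ f0 _] := Xf; have := f0 z; nra.
Qed.

(** Profit rises up to the threshold and falls after it. Without a threshold it rises everywhere,
    hence is bounded by its arbitrarily small upper bounds at high prices. *)
Lemma virtual_value_optimal : optimal_pricing q (virtual_value X f).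
Proof.
move=> c; split=> [p below above|below].
  apply: (max_profit_attained Dq) => x; have [px|/ltW xp] := leP p x.
    by apply: profit_decreasing => // z /andP[pz _]; exact: above.
  by apply: profit_increasing => // z /andP[_ zp]; exact: below.
apply/eqP; rewrite eq_le max_profit_ge0// andbT; apply: max_profit_le => x.
apply/ler_addgt0Pr => e e0; rewrite add0r.
have [x0 Hx0] := profit_vanishing Dq c e0.
have /Hx0 : x0 <= Num.max x x0 by rewrite le_max lexx orbT.
apply: le_trans; apply: profit_increasing => //.
by rewrite le_max lexx.
Qed.

Lemma myerson_value_optimal : optimal_pricing q (myerson_value X f).
Proof.
rewrite /optimal_pricing /myerson_value; case: asboolP => _.
  exact: virtual_value_optimal.
by rewrite ironed_virtual_valueE; exact: (ironed_slope_optimal Dq).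
Qed.

Lemma myerson_value_nondecreasing :
  {homo myerson_value X f : x y / x <= y >-> (x <= y)%E}.
Proof.
rewrite /myerson_value; case: asboolP => [//|_].
by rewrite ironed_virtual_valueE; exact: (ironed_slope_nondecreasing Dq).
Qed.

Lemma myerson_value_lt0 x : x < 0 -> (myerson_value X f x < 0)%E.
Proof.
rewrite /myerson_value; case: asboolP => [_ x0|_].
  by rewrite (le_lt_trans (virtual_value_le x))// lte_fin.
by rewrite ironed_virtual_valueE; exact: (ironed_slope_lt0 Dq).
Qed.

End virtual_values.

(** * Expected virtual surplus *)

Section tail_integral.
Context (d : measure_display) (Omega : measurableType d) (R : realType)
  (P : probability Omega R) (Y : Omega -> \bar R) (S : R -> R).
Context (mY : measurable_fun [set: Omega] Y).

Let level (c : R) := [set w | (c%:E <= Y w)%E].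
Let G (c : R) : R := fine (P (level c)).

Context (S_increment : forall c c' : R, 0 <= c -> c <= c' ->
  (c' - c) * G c' <= S c - S c' <= (c' - c) * G c)
  (S_vanishing : forall e : R, 0 < e ->
    exists2 c0 : R, 0 <= c0 & forall c, c0 <= c -> `|S c| <= e).

Let measurable_level c : measurable (level c).
Proof. by rewrite -[level c]setTI; exact: emeasurable_fun_c_infty. Qed.

Let GE c : (G c)%:E = P (level c).
Proof. by rewrite fineK// fin_num_measure. Qed.

Section truncation.
Context (K : R) (K0 : 0 <= K).

Let Z (w : Omega) : R := fine (mine (maxe 0%E (Y w)) K%:E).
Let excess (c : R) (w : Omega) : R := Num.max (Z w - c) 0.

Let ZE w : (Z w)%:E = mine (maxe 0%E (Y w)) K%:E.
Proof.
rewrite fineK// fin_numE gt_eqF ?lt_eqF//.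
  by rewrite gt_min ltry orbT.
by rewrite lt_min ltNyr lt_max ltNyr.
Qed.

Let measurable_excess c : measurable_fun [set: Omega] (EFin \o excess c).
Proof.
apply/measurable_EFinP; apply: measurable_maxr => //.
apply: measurable_funB => //; apply: (measurableT_comp (@fine_measurable _ _ _)) => //.
apply: measurable_mine => //; apply: measurable_maxe => //.
Qed.

Let excess_ge0 c w : 0 <= excess c w. Proof. by rewrite le_max lexx orbT. Qed.

Let excess_le c w : 0 <= c -> excess c w <= K.
Proof.
move=> c0; rewrite ge_max K0 andbT lerBlDr (le_trans (y := K)) ?lerDl//.
by rewrite -lee_fin ZE ge_min lexx orbT.
Qed.

Let integral_indicZ k (A : set Omega) : 0 <= k -> measurable A ->
  (\int[P]_w (k * \1_A w)%:E)%E = (k%:E * P A)%E.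
Proof.
move=> k0 mA; under eq_integral do rewrite EFinM.
by rewrite ge0_integralZl_EFin// ?integral_indic ?setIT//; apply/measurable_EFinP.
Qed.

Let D (c : R) : R := fine (\int[P]_w (excess c w)%:E)%E.

Let DE c : 0 <= c -> (D c)%:E = (\int[P]_w (excess c w)%:E)%E.
Proof.
move=> c0; rewrite fineK// ge0_fin_numE; last first.
  by apply: integral_ge0 => w _; rewrite lee_fin.
apply: (@le_lt_trans _ _ (\int[P]_w (cst K%:E w))%E).
  apply: ge0_le_integral => //; first by move=> w _; rewrite lee_fin.
  - exact: measurable_excess.
  - by move=> w _; rewrite lee_fin excess_le.
by rewrite integral_cst//= probability_setT mule1 ltry.
Qed.

(** Raising the cost lowers the excess by [c' - c] where [Y >= c'], and by at most that where
    [Y >= c]. As [c' <= K], truncation does not alter these events. *)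
Let D_increment c c' : 0 <= c -> c <= c' -> c' <= K ->
  (c' - c) * G c' <= D c - D c' <= (c' - c) * G c.
Proof.
move=> c0 cc cK; have c'0 := le_trans c0 cc.
have cc0 : 0 <= c' - c by rewrite subr_ge0.
have mi A : measurable A ->
    measurable_fun [set: Omega] (fun w => ((c' - c) * \1_A w)%:E).
  by move=> mA; apply/measurable_EFinP; apply: measurable_funM.
have i0 A w : (0 <= ((c' - c) * \1_A w)%:E)%E by rewrite lee_fin mulr_ge0.
have D'E a : 0 <= a ->
    ((D c')%:E + ((c' - c) * G a)%:E)%E =
    (\int[P]_w ((excess c' w)%:E + ((c' - c) * \1_(level a) w)%:E))%E.
  move=> a0; rewrite ge0_integralD//; first by rewrite DE// integral_indicZ// EFinM GE.
  - by move=> w _; rewrite lee_fin.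
  - exact: measurable_excess.
  - exact: mi.
suff : D c' + (c' - c) * G c' <= D c /\ D c <= D c' + (c' - c) * G c.
  by move=> [? ?]; apply/andP; split; lra.
split.
  rewrite -lee_fin EFinD D'E// DE//; apply: ge0_le_integral => //.
  - by move=> w _; rewrite adde_ge0// lee_fin.
  - by apply: emeasurable_funD; [exact: measurable_excess|exact: mi].
  - exact: measurable_excess.
  move=> w _; rewrite -EFinD lee_fin indicE; case: (boolP (w \in _)) => [|_].
    rewrite inE /level/= => Yw; rewrite mulr1.
    have : c' <= Z w by rewrite -lee_fin ZE le_min le_max Yw orbT lee_fin.
    by move=> cZ; rewrite /excess !max_l; lra.
  by rewrite mulr0 addr0 /excess ge_max !le_max lexx orbT andbT; apply/orP; left; lra.
rewrite -lee_fin EFinD D'E// DE//; apply: ge0_le_integral => //.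
- by move=> w _; rewrite lee_fin.
- exact: measurable_excess.
- by apply: emeasurable_funD; [exact: measurable_excess|exact: mi].
move=> w _; rewrite -EFinD lee_fin indicE; case: (boolP (w \in _)) => [_|].
  rewrite mulr1 /excess ge_max; apply/andP; split.
    by rewrite -lerBlDr le_max; apply/orP; left; lra.
  by rewrite addr_ge0// le_max lexx orbT.
rewrite notin_setE /level/= => /negP; rewrite -ltNge => Yc.
rewrite mulr0 addr0 /excess ge_max !le_max lexx orbT andbT.
apply/orP; right; rewrite subr_le0 -lee_fin ZE ge_min ge_max lee_fin c0.
by rewrite (ltW Yc).
Qed.

(* [S] and [D] have increments in the same short intervals, hence differ by a
   constant. *)
Lemma integral_truncated c : 0 <= c -> c <= K ->
  (\int[P]_w (Num.max (fine (mine (maxe 0%E (Y w)) K%:E) - c) 0)%:E)%E =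
  (S c - S K)%:E.
Proof.
move=> c0 cK; rewrite -[LHS]/(\int[P]_w (excess c w)%:E)%E -DE//; congr EFin.
have -> : S c - S K = S c - S K + D K.
  suff -> : D K = 0 by rewrite addr0.
  rewrite /D integral0_eq// => w _; congr EFin; apply/max_idPr.
  by rewrite subr_le0 -lee_fin ZE ge_min lexx orbT.
apply/le_anti/andP; split.
  have := @le_of_increment_le _ (fun x => S x - D x) (fun x => - G x) _ _ cK.
  suff: forall x y, c <= x -> x <= y -> y <= K ->
     S y - D y - (S x - D x) <= (y - x) * (- G y - - G x) by move=> H /(_ H); lra.
  move=> x y cx xy yK; have x0 := le_trans c0 cx.
  have /andP[] := S_increment x0 xy; have /andP[] := D_increment x0 xy yK.
  lra.
have := @le_of_increment_le _ (fun x => D x - S x) (fun x => - G x) _ _ cK.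
suff: forall x y, c <= x -> x <= y -> y <= K ->
   D y - S y - (D x - S x) <= (y - x) * (- G y - - G x) by move=> H /(_ H); lra.
move=> x y cx xy yK; have x0 := le_trans c0 cx.
have /andP[] := S_increment x0 xy; have /andP[] := D_increment x0 xy yK.
lra.
Qed.

End truncation.

(** A layer-cake formula, with [S] in the role of the integrated tail. Since [Y] may be infinite, it
    is first proved for truncations, where it reads [S c - S n]; monotone convergence and the
    vanishing of [S] give the limit, so finiteness is a conclusion. *)
Lemma integral_excess c : 0 <= c ->
  (\int[P]_w maxe 0%E (Y w - c%:E))%E = (S c)%:E.
Proof.
move=> c0.
pose g n w : \bar R :=
  (Num.max (fine (mine (maxe 0%E (Y w)) n%:R%:E) - c) 0)%:E.
have mg n : measurable_fun [set: Omega] (g n).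
  apply/measurable_EFinP; apply: measurable_maxr => //.
  apply: measurable_funB => //.
  apply: (measurableT_comp (@fine_measurable _ _ _)) => //.
  by apply: measurable_mine => //; apply: measurable_maxe.
have g0 n w : (0 <= g n w)%E by rewrite lee_fin le_max lexx orbT.
have nd w : {homo g ^~ w : n m / (n <= m)%N >-> (n <= m)%E}.
  move=> n m nm; rewrite lee_fin ge_max !le_max lexx orbT andbT lerD2r.
  rewrite fine_le//.
  - rewrite fin_numE gt_eqF ?lt_eqF ?gt_min ?ltry ?orbT//.
    by rewrite lt_min ltNyr lt_max ltNyr.
  - rewrite fin_numE gt_eqF ?lt_eqF ?gt_min ?ltry ?orbT//.
    by rewrite lt_min ltNyr lt_max ltNyr.
  - by rewrite le_min !ge_min lexx /= lee_fin ler_nat nm orbT.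
have /= := @cvg_monotone_convergence _ _ _ P _ measurableT g mg
  (fun n w _ => g0 n w) (fun w _ => nd w).
have -> : (\int[P]_w limn (g ^~ w))%E = (\int[P]_w maxe 0%E (Y w - c%:E))%E.
  apply: eq_integral => w _; apply/cvg_lim => //.
  rewrite /g; case: (Y w) => [y||] /=.
  - apply: cvg_near_cst; exists (Num.bound `|y|) => // n /= yn.
    have /min_idPl -> : (maxe 0%E y%:E <= n%:R%:E)%E.
      rewrite ge_max !lee_fin ler0n (le_trans (ler_norm _))//.
      by rewrite (le_trans (ltW (archi_boundP (normr_ge0 _))))// ler_nat.
    rewrite -EFin_max/= -EFinB -EFin_max; congr EFin.
    by case: (leP 0 y) => y0; [rewrite maxC|rewrite max_r ?max_l//; lra].
  - have -> : maxe 0%E +oo%E = +oo%E :> \bar R by rewrite max_r ?leey.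
    apply/cvgeyPge => A.
    exists (Num.bound `|A + c|) => // n An.
    rewrite (_ : mine +oo%E _ = n%:R%:E) ?min_r ?leey//= lee_fin.
    rewrite le_max lerBrDr (le_trans (ler_norm _))//.
    by rewrite (le_trans (ltW (archi_boundP (normr_ge0 _))))// ler_nat.
  - rewrite (_ : maxe 0%E -oo%E = 0%E) ?max_l//.
    apply: cvg_near_cst; exists 0%N => // n _.
    rewrite (_ : mine 0%E _ = 0%E) ?min_l ?lee_fin//= sub0r; congr EFin.
    by apply/max_idPr; rewrite oppr_le0.
move=> cv; apply: (cvg_unique _ cv) => //.
apply/fine_cvgP; split.
  exists (Num.bound c) => // n /= cn; rewrite integral_truncated//.
  by rewrite (le_trans (ltW (archi_boundP c0)))// ler_nat.
apply/cvgrPdist_le => e e0; have [c1 c10 Hc1] := S_vanishing e0.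
exists (maxn (Num.bound c) (Num.bound c1)) => // n /=.
rewrite geq_max => /andP[cn c1n]; rewrite integral_truncated//=; last first.
  by rewrite (le_trans (ltW (archi_boundP c0)))// ler_nat.
rewrite subKr Hc1// (le_trans (ltW (archi_boundP c10)))// ler_nat//.
Qed.

End tail_integral.

Lemma nondecreasing_emeasurable (R : realType) (g : R -> \bar R) :
  {homo g : x y / x <= y >-> (x <= y)%E} -> measurable_fun [set: R] g.
Proof.
move=> g_nd; apply: (measurability (@ErealGenCInfty.G R)) => [|/= _ [_] [r] -> <-].
  exact: ErealGenCInfty.measurableE.
rewrite setTI; apply: is_interval_measurable => s t/=.
rewrite !in_itv/= !andbT => gs gt u /andP[su ut].
by rewrite in_itv/= andbT (le_trans gs)// g_nd.
Qed.

(** * Posted prices compared with positive virtual values *)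

Section virtual_surplus.
Context (d : measure_display) (Omega : measurableType d) (R : realType)
  (P : probability Omega R) (X : {RV P >-> R}) (f : R -> R)
  (iX : P.-integrable [set: Omega] (EFin \o X)) (Xf : has_density X f)
  (phi : R -> \bar R) (phi_nd : {homo phi : x y / x <= y >-> (x <= y)%E})
  (phi_lt0 : forall x, x < 0 -> (phi x < 0)%E)
  (phi_opt : optimal_pricing (sale_prob X) phi).

Let q := sale_prob X.
Let Dq : demand_axioms q := sale_prob_demand iX Xf.
Let S := max_profit q.

Let measurable_phiX : measurable_fun [set: Omega] (phi \o X).
Proof. by apply: measurableT_comp => //; exact: nondecreasing_emeasurable. Qed.

Let measurable_pos : measurable_fun [set: Omega] (fun w => maxe 0%E (phi (X w))).
Proof. exact: measurable_maxe. Qed.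

(* Ties have probability 0. *)
Lemma threshold_event (E : set Omega) t : measurable E ->
  (forall w, E w -> t <= X w) -> (forall w, ~ E w -> X w <= t) ->
  P E = (sale_prob X t)%:E.
Proof.
move=> mE Et Et'; apply/eqP; rewrite eq_le; apply/andP; split.
  rewrite (sale_prob_geE Xf); apply: le_measure; rewrite ?inE//.
    exact: measurable_funPTI.
  by move=> w /Et; rewrite /= in_itv/= andbT.
rewrite sale_probE; apply: le_measure; rewrite ?inE//.
  exact: measurable_funPTI.
move=> w /=; rewrite in_itv/= andbT => tX; apply: contrapT => /Et'.
by rewrite leNgt tX.
Qed.

(** As [c >= 0], [phi_lt0] makes 0 a lower bound of the level set, so its infimum is a genuine
    threshold. *)
Let threshold c : 0 <= c ->
  (exists p, (forall s, s < p -> (phi s < c%:E)%E) /\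
     (forall s, p < s -> (c%:E <= phi s)%E)) \/ (forall s, (phi s < c%:E)%E).
Proof.
move=> c0; have [low|high] := pselect (forall s, (phi s < c%:E)%E); first by right.
left; pose A := [set s | (c%:E <= phi s)%E].
have lbA : has_lbound A.
  exists 0 => s; apply: contraPle => /phi_lt0 s0 /(le_lt_trans)/(_ s0).
  by rewrite lte_fin ltNge c0.
have A0 : A !=set0.
  apply: contrapT => A0; apply: high => s; rewrite ltNge; apply/negP => cs.
  by apply: A0; exists s.
exists (inf A); split=> s sA.
  by rewrite ltNge; apply/negP => cs; move: sA; rewrite ltNge ge_inf.
have [t ct ts] := inf_lt A0 sA.
exact: le_trans ct (phi_nd (ltW ts)).
Qed.

Let G (c : R) : R := fine (P [set w | (c%:E <= phi (X w))%E]).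

Let measurable_ge (c : \bar R) : measurable [set w | (c <= phi (X w))%E].
Proof. by rewrite -[X in measurable X]setTI; exact: emeasurable_fun_c_infty. Qed.

Let G_case c : 0 <= c ->
  (exists2 p, S c = profit q c p & G c = q p) \/ (S c = 0 /\ G c = 0).
Proof.
move=> c0; have [opt1 opt2] := phi_opt c.
have [[p [below above]]|below] := threshold c0; [left|right].
  exists p; first exact: opt1.
  rewrite /G (threshold_event (t := p))// => w /= cw.
    by rewrite leNgt; apply/negP => /below; rewrite ltNge cw.
  by rewrite leNgt; apply/negP => /above.
split; first exact: opt2.
rewrite /G (_ : [set w | _] = set0) ?measure0// -subset0 => w /=.
by rewrite leNgt below.
Qed.

(** Envelope inequalities: a price optimal for one cost is available at the other, where its profit
    differs by [c' - c] times its demand, and [G_case] identifies that demand with [G]. *)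
Let S_increment (c c' : R) : 0 <= c -> c <= c' ->
  (c' - c) * G c' <= S c - S c' <= (c' - c) * G c.
Proof.
move=> c0 cc; have c'0 := le_trans c0 cc; apply/andP; split.
  have [[p Sp ->]|[-> ->]] := G_case c'0; last first.
    by rewrite mulr0 subr0 max_profit_ge0.
  by have := le_max_profit Dq c p; rewrite Sp (@profit_costE _ q c c' p) -/S; lra.
have [[p Sp ->]|[-> ->]] := G_case c0; last first.
  by rewrite mulr0 sub0r oppr_le0 max_profit_ge0.
by have := le_max_profit Dq c' p; rewrite Sp (@profit_costE _ q c c' p) -/S; lra.
Qed.

Lemma expected_virtual_excess c : 0 <= c ->
  (\int[P]_w maxe 0 (phi (X w) - c%:E))%E = (max_profit (sale_prob X) c)%:E.
Proof.
move=> c0; apply: (@integral_excess _ _ _ P (phi \o X) S) => // e e0.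
have [c1 c10 Hc1] := max_profit_vanishing Dq e0; exists c1 => // c' cc.
by rewrite ger0_norm ?Hc1// max_profit_ge0.
Qed.

(** On [E] the positive part is [c] plus the excess over [c], and off [E] there is no excess. Types
    tied at [c] may lie on either side. *)
Let integral_pos_event (E : set Omega) (c : R) : measurable E -> 0 <= c ->
  (forall w, E w -> (c%:E <= maxe 0 (phi (X w)))%E) ->
  (forall w, ~ E w -> (phi (X w) <= c%:E)%E) ->
  (\int[P]_(w in E) maxe 0 (phi (X w)) = c%:E * P E + (S c)%:E)%E.
Proof.
move=> mE c0 Ec Ec'.
have mexc : measurable_fun [set: Omega] (fun w => maxe 0%E (phi (X w) - c%:E)%E).
  by apply: measurable_maxe => //; exact: emeasurable_funB.
rewrite -expected_virtual_excess// -(integral_cst P mE c%:E).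
have -> : (\int[P]_w maxe 0 (phi (X w) - c%:E) =
    \int[P]_(w in E) maxe 0 (phi (X w) - c%:E))%E.
  rewrite [RHS]integral_mkcond; apply: eq_integral => w _; rewrite patchE.
  case: ifPn => //; rewrite notin_setE => /Ec' cw.
  by apply/max_idPl; rewrite sube_le0.
rewrite -ge0_integralD//.
- apply: eq_integral => w; rewrite inE => /Ec.
  rewrite le_max => /orP[|cw].
    rewrite lee_fin => c0'; have -> : c = 0 by apply/le_anti; rewrite c0'.
    by rewrite add0e sube0.
  have phi_ge0 : (0 <= phi (X w))%E by rewrite (le_trans _ cw)// lee_fin.
  have excess_ge0 : (0 <= phi (X w) - c%:E)%E by rewrite sube_ge0.
  by rewrite (max_r phi_ge0) (max_r excess_ge0) [RHS]addeC subeK.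
- by move=> w _; rewrite le_max lexx.
- exact: measurable_funTS.
Qed.

Let integral_pos_lty (E : set Omega) : measurable E ->
  (\int[P]_(w in E) maxe 0 (phi (X w)) < +oo)%E.
Proof.
move=> mE; rewrite (le_lt_trans _ (ltry (S 0)))// -(expected_virtual_excess (lexx 0)).
under [leRHS]eq_integral do rewrite sube0.
by apply: ge0_subset_integral => // w _; rewrite le_max lexx.
Qed.

Let infinite_null (E : set Omega) : measurable E ->
  (forall w, E w -> maxe 0%E (phi (X w)) = +oo%E) -> P E = 0%E.
Proof.
move=> mE Ey; apply/eqP; rewrite eq_le measure_ge0 andbT leNgt; apply/negP => PE0.
have := integral_pos_lty mE; rewrite ltNge => /negP; apply.
rewrite (eq_integral (cst +oo%E)); last by move=> w; rewrite inE => /Ey.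
by rewrite integral_cst// gt0_mulye.
Qed.

(** With [c] the positive part of [phi t], the revenue [t * q t] is [c * q t + profit q c t], and
    the profit is at most [S c]. If [c] is infinite, the event is null. *)
Lemma posted_price_le (E : set Omega) t : measurable E ->
  (forall w, E w -> t <= X w) -> (forall w, ~ E w -> X w <= t) ->
  (t%:E * P E <= \int[P]_(w in E) maxe 0 (phi (X w)))%E.
Proof.
move=> mE Et Et'; have PE := threshold_event mE Et Et'.
have [ty|ty] := eqVneq (maxe 0%E (phi t)) +oo%E.
  rewrite infinite_null// ?mule0; last first.
    move=> w /Et tw; apply/eqP; rewrite -leye_eq -ty ge_max !le_max lexx /=.
    by rewrite phi_nd ?orbT.
  by apply: integral_ge0 => w _; rewrite le_max lexx.
have [c c0 cE] : exists2 c : R, 0 <= c & maxe 0%E (phi t) = c%:E.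
  have : maxe 0%E (phi t) \is a fin_num.
    by rewrite fin_numElt ltey ty andbT (@lt_le_trans _ _ 0%E)// le_max lexx.
  move=> /fineK cE; exists (fine (maxe 0%E (phi t))) => //.
  by rewrite fine_ge0// le_max lexx.
rewrite (@integral_pos_event E c)//.
- rewrite PE -!EFinM -EFinD lee_fin -/(q t).
  by have := le_max_profit Dq c t; rewrite /profit -/S; lra.
- by move=> w /Et tw; rewrite -cE ge_max !le_max lexx /= phi_nd ?orbT.
- move=> w /Et' wt; rewrite -cE le_max phi_nd ?orbT//.
Qed.

(** A builder who loses ties must exceed [c] strictly, while [optimal_pricing] concerns weak level
    sets. Costs [c'] slightly above [c] have thresholds at or just right of [p], and profits are
    continuous in price and cost. *)
Let strict_threshold (c p : R) : 0 <= c ->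
  (forall s, (c%:E < phi s)%E -> p <= s) -> (forall s, p < s -> (c%:E < phi s)%E) ->
  S c = profit q c p.
Proof.
move=> c0 low high; apply/le_anti; rewrite le_max_profit// andbT.
apply/ler_addgt0Pr => e e0; have e20 : 0 < e / 2 by lra.
have := @profit_continuous _ _ Dq c p => /cvgrPdist_le/(_ _ e20)/nbhs_ballP[h /= h0 Hh].
have near z : `|p - z| < h -> profit q c z <= profit q c p + e / 2.
  move=> /Hh/=; rewrite distrC => /(le_trans (ler_norm _)); lra.
have ps : p < p + h / 2 by rewrite ltrDl divr_gt0.
have := high _ ps; set s := p + h / 2 => cs.
(* The bound [c + e / 2] limits the change in maximal profit; the bound [phi s] keeps the threshold
   of [c'] at most [s], within [h] of [p]. *)
have [c' [cc c'e c's]] : exists c', [/\ c < c', c' <= c + e / 2 & (c'%:E <= phi s)%E].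
  case: (phi s) cs => [r|_|//]; last first.
    by exists (c + e / 2); rewrite leey ltrDl e20.
  rewrite lte_fin => cr; exists (Num.min (c + e / 2) r).
  by rewrite lee_fin lt_min cr ltrDl e20 !ge_min !lexx orbT.
have c'0 : 0 <= c' by rewrite (le_trans c0)// ltW.
have [[p' [below above]]|] := threshold c'0; last first.
  by move=> /(_ s); rewrite ltNge c's.
have pp' : p <= p'.
  rewrite leNgt; apply/negP => p'p.
  have /above : p' < (p' + p) / 2 by lra.
  move=> /(lt_le_trans _) -/(_ c%:E); rewrite lte_fin => /(_ cc)/low; lra.
have p's : p' <= s by rewrite leNgt; apply/negP => /below; rewrite ltNge c's.
have := near p'; rewrite ler0_norm; last by lra.
have -> : - (p - p') < h by move: p's; rewrite /s; lra.
move=> /(_ isT).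
have := profit_le_cost Dq p' (ltW cc).
have Sc' := (phi_opt c').1 _ below above.
have : S c <= S c' + (c' - c).
  apply: max_profit_le => x; rewrite (@profit_costE _ q c c' x).
  rewrite lerD ?le_max_profit// ler_piMr ?(demand_le1 Dq)//; lra.
rewrite {2}/S Sc'; lra.
Qed.

(** [b] records whether a tie at [c] is won. The level [c] is extended because a rival may have
    virtual value [+oo]; winning against it has probability 0. *)
Lemma threshold_price_ge (E : set Omega) (c : \bar R) (b : bool) (p : R) :
  (0 <= c)%E ->
  let A s := if b then (c <= phi s)%E else (c < phi s)%E in
  (forall w, E w <-> A (X w)) ->
  (forall s, A s -> p <= s) -> (forall s, p < s -> A s) ->
  (\int[P]_(w in E) maxe 0 (phi (X w)) <= p%:E * P E)%E.
Proof.
move=> c0 A EA lowp highp.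
have mE : measurable E.
  have -> : E = [set w | A (X w)] by apply/seteqP; split => w /EA.
  rewrite /A; case: b {A EA lowp highp} => //.
  by rewrite -[X in measurable X]setTI; exact: emeasurable_fun_o_infty.
have PE : P E = (q p)%:E.
  apply: threshold_event => // w; first by move=> /EA/lowp.
  by move=> nE; rewrite leNgt; apply/negP => /highp/EA.
have Ac s : A s -> (c <= phi s)%E by rewrite /A; case: (b) => // /ltW.
have Ac' s : ~ A s -> (phi s <= c)%E.
  by rewrite /A; case: (b) => /negP; rewrite -?ltNge -?leNgt// => /ltW.
case: c => [c||//] in c0 A EA lowp highp Ac Ac' *; last first.
  have PE0 : P E = 0%E.
    apply: infinite_null => // w /EA/Ac; rewrite leye_eq => /eqP ->.
    by rewrite max_r ?leey.
  by rewrite PE0 mule0 null_set_integral//; exact: measurable_funTS.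
rewrite lee_fin in c0.
have SE : S c = profit q c p.
  case: b => [|] in A EA lowp highp Ac Ac'; last exact: strict_threshold.
  apply: (phi_opt c).1 => // s; rewrite ltNge => sp; rewrite ltNge.
  by apply: contraNN sp; exact: lowp.
rewrite (@integral_pos_event E c)//.
- rewrite PE -!EFinM -EFinD lee_fin SE /profit; lra.
- by move=> w /EA/Ac cw; rewrite le_max cw orbT.
- by move=> w nE; apply: Ac' => /EA.
Qed.

End virtual_surplus.

(** * Incentive compatible mechanisms *)

Section incentive_bound.
Context (d : measure_display) (Omega : measurableType d) (R : realType)
  (P : probability Omega R) (X : {RV P >-> R}) (f : R -> R)
  (iX : P.-integrable [set: Omega] (EFin \o X)) (Xf : has_density X f)
  (phi : R -> \bar R) (phi_nd : {homo phi : x y / x <= y >-> (x <= y)%E})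
  (phi_lt0 : forall x, x < 0 -> (phi x < 0)%E)
  (phi_opt : optimal_pricing (sale_prob X) phi).

(* [U] and [Q] are the interim payoff and winning probability of a truthful
   builder, as functions of the type. *)
Context (T : set R) (U Q : R -> R) (XT : forall w, T (X w))
  (U_ge0 : forall x, T x -> 0 <= U x)
  (U_convex : forall x r, T x -> T r -> U r + (x - r) * Q r <= U x)
  (Q_ge0 : forall x, T x -> 0 <= Q x) (Q_le1 : forall x, T x -> Q x <= 1)
  (mQ : measurable_fun [set: Omega] (Q \o X))
  (ipay : P.-integrable [set: Omega] (fun w => (X w * Q (X w) - U (X w))%:E)).

Let Q_monotone x r : T x -> T r -> r <= x -> Q r <= Q x.
Proof.
move=> Tx Tr; rewrite le_eqVlt => /predU1P[->//|rx].
have := U_convex Tx Tr; have := U_convex Tr Tx => h1 h2.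
have : 0 <= (x - r) * (Q x - Q r) by lra.
by rewrite pmulr_rge0 ?subr_gt0// subr_ge0.
Qed.

Section discretization.
Context (N : nat).
Let eta : R := N.+1%:R^-1.
Let eta_gt0 : 0 < eta. Proof. by rewrite invr_gt0. Qed.

Let A (j : nat) := [set x | T x /\ j.+1%:R * eta <= Q x].
(** The price of the slice of winning probability between [j * eta] and [j.+1 * eta]. If [A j] is
    empty the value is a default, but then so is [E j]. *)
Let t (j : nat) := inf (A j).
Let E (j : nat) := [set w | j.+1%:R * eta <= Q (X w)].

(** A very low type [r] winning this often has a nonnegative payoff, so imitating it would give a
    fixed type [x] more than [U x]. *)
Let has_lbound_A j : has_lbound (A j).
Proof.
have [->|/set0P[x [Tx jx]]] := eqVneq (A j) set0; first by exists 0 => r [].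
have k0 : 0 < j.+1%:R * eta by rewrite mulr_gt0.
exists (x - `|U x / (j.+1%:R * eta)|) => r [Tr jr].
have [xr|rx] := leP x r; first by rewrite lerBlDr ler_wpDr.
rewrite lerBlDr -lerBlDl (le_trans _ (ler_norm _))// ler_pdivlMr//.
have : (x - r) * (j.+1%:R * eta) <= (x - r) * Q r.
  by rewrite ler_wpM2l// subr_ge0 ltW.
have := U_convex Tx Tr; have := U_ge0 Tr; lra.
Qed.

(** The payoff is at least that of buying [J] slices at their prices. In the induction, [x] imitates
    some [r] in [A J]: the hypothesis at [r] pays for the first [J] slices, and [(x - r) * Q r]
    supplies the rest. *)
Let payoff_ge J x : T x -> J%:R * eta <= Q x ->
  eta * (J%:R * x - \sum_(j < J) t j) <= U x.
Proof.
elim: J x => [x Tx _|J IH x Tx Jx]; first by rewrite big_ord0 mul0r subrr mulr0 U_ge0.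
have JJ : J%:R * eta <= J.+1%:R * eta by rewrite ler_wpM2r ?ler_nat// ltW.
have below r : A J r -> r <= x ->
    eta * (J.+1%:R * x - r - \sum_(j < J) t j) <= U x.
  move=> [Tr Jr] rx; have := U_convex Tx Tr; have := IH r Tr (le_trans JJ Jr).
  have : (x - r) * (J.+1%:R * eta) <= (x - r) * Q r by rewrite ler_wpM2l// subr_ge0.
  rewrite -natr1; lra.
(* The infimum [t J] need not be a type, so the inequality is solved for [r] and becomes a lower
   bound of [A J]. *)
suff : J.+1%:R * x - \sum_(j < J) t j - U x / eta <= t J.
  rewrite big_ord_recr/= => h; have : U x / eta * eta = U x by rewrite divfK// gt_eqF.
  have := ler_wpM2l (ltW eta_gt0) h; lra.
have bound r : A J r -> r <= x -> J.+1%:R * x - \sum_(j < J) t j - U x / eta <= r.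
  move=> Ar /(below _ Ar) h; have : U x / eta * eta = U x by rewrite divfK// gt_eqF.
  move=> h2; rewrite -(ler_pM2l eta_gt0); lra.
apply: lb_le_inf; first by exists x.
move=> r Ar; have [rx|/ltW xr] := leP r x; first exact: bound.
by rewrite (le_trans _ xr)// bound.
Qed.

Let level_count x : T x ->
  exists J, [/\ (J <= N.+1)%N, J%:R * eta <= Q x, Q x <= J.+1%:R * eta &
    forall j, (j.+1%:R * eta <= Q x) = (j < J)%N].
Proof.
move=> Tx; have Qx0 : 0 <= Q x * N.+1%:R by rewrite mulr_ge0 ?Q_ge0.
have etaE z : (z * eta <= Q x) = (z <= Q x * N.+1%:R) by rewrite ler_pdivrMr.
have /andP[lo hi] := Num.Theory.truncn_itv Qx0.
set J := Num.truncn _ in lo hi; exists J; split.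
- have : J%:R <= N.+1%:R :> R.
    by rewrite (le_trans lo)// -[leRHS]mul1r ler_wpM2r// Q_le1.
  by rewrite ler_nat.
- by rewrite etaE.
- by rewrite /eta ler_pdivlMr// ltW.
- move=> j; rewrite etaE; apply/idP/idP => [jQ|jJ].
    by have := le_lt_trans jQ hi; rewrite ltr_nat ltnS.
  by rewrite (le_trans _ lo)// ler_nat.
Qed.

(** Winning probability left over after the last full slice is at most [eta], hence worth at most
    [eta * |x|]. *)
Let pay_le x : T x -> x * Q x - U x <=
  eta * `|x| + \sum_(j < N.+1) eta * t j * (j.+1%:R * eta <= Q x)%R%:R.
Proof.
move=> Tx; have [J [JN Jlo Jhi Jlevel]] := level_count Tx.
have -> : \sum_(j < N.+1) eta * t j * (j.+1%:R * eta <= Q x)%R%:R =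
    eta * \sum_(j < J) t j.
  rewrite mulr_sumr (big_ord_widen _ (fun j => eta * t j) JN) [RHS]big_mkcond/=.
  by apply: eq_bigr => j _; rewrite Jlevel; case: ltnP => _; rewrite ?mulr1 ?mulr0.
have := payoff_ge Tx Jlo.
have : x * (Q x - J%:R * eta) <= `|x| * eta.
  rewrite (le_trans (ler_norm _))// normrM ler_wpM2l// ger0_norm; last lra.
  by move: Jhi; rewrite -natr1; lra.
lra.
Qed.

Let measurable_E j : measurable (E j).
Proof.
rewrite -[E j]setTI.
have -> : E j = (Q \o X) @^-1` `[j.+1%:R * eta, +oo[.
  by apply/seteqP; split=> w; rewrite /E /= in_itv/= andbT.
exact: mQ.
Qed.

Let level_price_le j : ((t j)%:E * P (E j) <=
  \int[P]_(w in E j) maxe 0 (phi (X w)))%E.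
Proof.
have [E0|/set0P[w0 Ew0]] := eqVneq (E j) set0.
  by rewrite E0 measure0 mule0 integral_set0.
apply: (posted_price_le iX Xf phi_nd phi_lt0 phi_opt) => // w Ew.
  by apply: ge_inf => //; split.
apply: lb_le_inf; first by exists (X w0); split.
move=> r [Tr jr]; rewrite leNgt; apply/negP => /ltW rX; apply: Ew.
by rewrite /E/= (le_trans jr)// Q_monotone.
Qed.

Lemma incentive_bound_discrete :
  (\int[P]_w (X w * Q (X w) - U (X w))%:E <=
   eta%:E * \int[P]_w `|(X w)%:E| +
   \int[P]_w (maxe 0 (phi (X w)) * (Q (X w))%:E))%E.
Proof.
have mpos : measurable_fun [set: Omega] (fun w => maxe 0%E (phi (X w))).
  apply: measurable_maxe => //; apply: measurableT_comp => //.
  exact: nondecreasing_emeasurable.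
have iE k j : P.-integrable [set: Omega] (fun w => (k * \1_(E j) w)%:E).
  rewrite (_ : (fun _ => _) = fun w => (k%:E * (\1_(E j) w)%:E)%E).
    by apply: integrableZl => //; exact: integrable_indic.
  by apply/funext => w; rewrite EFinM.
have iabs : P.-integrable [set: Omega] (fun w => (eta * `|X w|)%:E).
  rewrite (_ : (fun _ => _) = fun w => (eta%:E * `|(X w)%:E|)%E).
    by apply: integrableZl => //; exact: (integrable_abse iX).
  by apply/funext => w; rewrite EFinM.
have isum : P.-integrable [set: Omega]
    (fun w => (\sum_(j < N.+1) (eta * t j * \1_(E j) w)%:E)%E).
  exact: integrable_sum.
apply: (@le_trans _ _ (\int[P]_w ((eta * `|X w|)%:E +
    \sum_(j < N.+1) (eta * t j * \1_(E j) w)%:E))%E).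
  apply: le_integral => //; first exact: integrableD.
  move=> w _; rewrite sumEFin -EFinD lee_fin; apply: le_trans (pay_le (XT w)) _.
  rewrite lerD2l; apply: ler_sum => j _; rewrite indicE.
  by rewrite (_ : (w \in E j) = (j.+1%:R * eta <= Q (X w)))//; apply/idP/idP; rewrite inE.
rewrite integralD//; apply: leeD.
  under eq_integral do rewrite EFinM.
  by rewrite ge0_integralZl_EFin// ?ltW//; apply/measurable_EFinP; exact: measurableT_comp.
rewrite integral_sum//.
apply: (@le_trans _ _ (\sum_(j < N.+1)
   \int[P]_w (eta%:E * (maxe 0 (phi (X w)) * (\1_(E j) w)%:E)))%E).
  apply: lee_sum => j _.
  rewrite ge0_integralZl_EFin//; last 3 first.
  - by move=> w _; rewrite mule_ge0// ?le_max ?lexx// lee_fin.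
  - by apply: emeasurable_funM => //; apply/measurable_EFinP.
  - exact: ltW.
  have -> : (\int[P]_w (maxe 0 (phi (X w)) * (\1_(E j) w)%:E) =
      \int[P]_(w in E j) maxe 0 (phi (X w)))%E.
    rewrite [RHS]integral_mkcond; apply: eq_integral => w _.
    by rewrite patchE indicE; case: (w \in E j); rewrite ?mule1 ?mule0.
  under eq_integral do rewrite EFinM.
  rewrite integralZl//; last exact: integrable_indic.
  rewrite integral_indic// setIT EFinM -muleA.
  by apply: lee_wpmul2l; [rewrite lee_fin ltW|exact: level_price_le].
have m1 j : measurable_fun [set: Omega]
    (fun w => eta%:E * (maxe 0 (phi (X w)) * (\1_(E j) w)%:E))%E.
  by apply: measurable_funeM; apply: emeasurable_funM => //; apply/measurable_EFinP.
have g0 j w : (0 <= eta%:E * (maxe 0 (phi (X w)) * (\1_(E j) w)%:E))%E.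
  by rewrite !mule_ge0// ?le_max ?lexx// lee_fin// ltW.
rewrite -ge0_integral_sum//; apply: ge0_le_integral => //.
- by move=> w _; apply: sume_ge0.
- by apply: emeasurable_sum => j.
- by apply: emeasurable_funM => //; apply/measurable_EFinP.
move=> w _; have [J [JN Jlo Jhi Jlevel]] := level_count (XT w).
under eq_bigr do rewrite muleCA -EFinM.
rewrite -ge0_sume_distrr; last by move=> j _; rewrite lee_fin mulr_ge0// ltW.
rewrite lee_wpmul2l ?le_max ?lexx// sumEFin lee_fin (le_trans _ Jlo)//.
rewrite -mulr_sumr mulrC; apply: ler_wpM2r; first exact: ltW.
rewrite (eq_bigr (fun j : 'I_N.+1 => if (j < J)%N then 1 else 0)); last first.
  move=> j _; rewrite indicE -Jlevel.
  by rewrite (_ : (w \in E j) = (j.+1%:R * eta <= Q (X w))); [case: ifP|apply/idP/idP; rewrite inE].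
by rewrite -big_mkcond -(big_ord_widen _ (fun=> 1) JN) sumr_const card_ord.
Qed.

End discretization.

Lemma incentive_bound :
  (\int[P]_w (X w * Q (X w) - U (X w))%:E <=
   \int[P]_w (maxe 0 (phi (X w)) * (Q (X w))%:E))%E.
Proof.
apply/lee_addgt0Pr => e e0.
have fX : (\int[P]_w `|(X w)%:E|)%E \is a fin_num.
  exact: integrable_fin_num (integrable_abse iX).
pose m := fine (\int[P]_w `|(X w)%:E|)%E.
(* This many slices make the rounding cost [eta * m] at most [e]. *)
apply: le_trans (incentive_bound_discrete (Num.bound `|m / e|)) _.
rewrite addeC leeD2l// -(fineK fX) -/m -EFinM lee_fin.
rewrite mulrC ler_pdivrMr// mulrC -ler_pdivrMr// (le_trans (ler_norm _))//.
by rewrite (le_trans (ltW (archi_boundP (normr_ge0 _))))// ler_nat.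
Qed.

End incentive_bound.

(** * Independent values *)

Section same_law.
Context (d1 d2 d : measure_display) (T1 : measurableType d1)
  (T2 : measurableType d2) (Y : measurableType d) (R : realType)
  (m1 : probability T1 R) (m2 : probability T2 R) (a : T1 -> Y) (b : T2 -> Y).
Context (ma : measurable_fun [set: T1] a) (mb : measurable_fun [set: T2] b)
  (ab : forall A, measurable A -> m1 (a @^-1` A) = m2 (b @^-1` A)).

Lemma ge0_integral_same_law (g : Y -> \bar R) : measurable_fun [set: Y] g ->
  (forall y, (0 <= g y)%E) ->
  (\int[m1]_x g (a x) = \int[m2]_x g (b x))%E.
Proof.
move=> mg g0.
have := ge0_integral_pushforward ma m1 measurableT mg (fun y _ => g0 y).
have := ge0_integral_pushforward mb m2 measurableT mg (fun y _ => g0 y).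
rewrite !preimage_setT => <- <-.
by apply: eq_measure_integral => A mA _; exact: ab.
Qed.

Lemma integrable_same_law (g : Y -> \bar R) : measurable_fun [set: Y] g ->
  m2.-integrable [set: T2] (g \o b) -> m1.-integrable [set: T1] (g \o a).
Proof.
move=> mg /integrableP[_ fin]; apply/integrableP; split.
  exact: measurableT_comp.
rewrite (@ge0_integral_same_law (fun y => `|g y|%E))//.
exact: measurableT_comp.
Qed.

Lemma integral_same_law (g : Y -> \bar R) : measurable_fun [set: Y] g ->
  m2.-integrable [set: T2] (g \o b) ->
  (\int[m1]_x g (a x) = \int[m2]_x g (b x))%E.
Proof.
move=> mg ib; have ia := integrable_same_law mg ib.
have := @integral_pushforward _ _ _ _ _ _ ma m1 setT _ mg ia measurableT.
have := @integral_pushforward _ _ _ _ _ _ mb m2 setT _ mg ib measurableT.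
rewrite !preimage_setT => <- <-.
by apply: eq_measure_integral => A mA _; exact: ab.
Qed.

End same_law.

Section resampling.
Context (d : measure_display) (Omega : measurableType d) (R : realType)
  (P : probability Omega R) (n : nat) (V : 'I_n -> {RV P >-> R})
  (V_independent : independent_values V).

Lemma measurable_profiles (A : 'I_n -> set R) :
  (forall i, measurable (A i)) -> measurable (profiles A).
Proof.
move=> mA; have -> : profiles A =
    \bigcap_(i in [set: 'I_n]) ((fun v : profile R n => tnth v i) @^-1` A i).
  by apply/seteqP; split=> [v Av i _|v Av i]; [exact: Av|exact: (Av i I)].
apply: fin_bigcap_measurable; first exact: finite_finset.
move=> i _; rewrite -[X in measurable X]setTI.
exact: (@measurable_tnth _ (measurableTypeR R) n i measurableT _ (mA i)).
Qed.

(** Independence speaks of rectangles; as a generating family stable under intersection they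
    determine a law on profiles. *)
Lemma measurable_profileE :
  measurable = <<s [set profiles A | A in
    [set A : 'I_n -> set R | forall i, measurable (A i)]] >> :> set (set (profile R n)).
Proof.
apply/seteqP; split; last first.
  apply: smallest_sub; first exact: sigma_algebra_measurable.
  by move=> _ [A mA <-]; exact: measurable_profiles.
apply: smallest_sub; first exact: smallest_sigma_algebra.
rewrite -bigcup_seq => B [i _ [C mC <-]]; apply: sub_sigma_algebra.
exists (fun j => if j == i then C else setT).
  by move=> j; case: ifP.
rewrite setTI; apply/seteqP; split=> v; first by move=> /(_ i); rewrite eqxx.
by move=> Cv j; case: eqP => // ->.
Qed.

Lemma measurable_value_profile : measurable_fun [set: Omega] (value_profile V).
Proof.
apply/measurable_fun_tnthP => i; rewrite (_ : _ \o _ = V i); first exact: (measurable_funPT (V i)).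
by apply/funext => w; rewrite /= tnth_mktuple.
Qed.

Lemma measurable_deviate (i : 'I_n) :
  measurable_fun [set: profile R n * measurableTypeR R]
    (fun z => deviate z.1 i z.2).
Proof.
apply/measurable_fun_tnthP => j.
have [->|ji] := eqVneq j i.
  rewrite (_ : _ \o _ = snd); first exact: measurable_snd.
  by apply/funext => z; rewrite /= tnth_mktuple eqxx.
rewrite (_ : _ \o _ = (fun v => tnth v j) \o fst).
  by apply: measurableT_comp => //; exact: measurable_tnth.
by apply/funext => z; rewrite /= tnth_mktuple (negbTE ji).
Qed.

(** With the first coordinate fixed, this is the deviation integrated in [interim_payoff]; over the
    product space it has the law of the truthful profile. *)
Definition resample (i : 'I_n) (w : Omega * Omega) : profile R n :=
  deviate (value_profile V w.2) i (V i w.1).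

Lemma measurable_resample (i : 'I_n) : measurable_fun [set: Omega * Omega] (resample i).
Proof.
apply/measurable_fun_tnthP => j; have [->|ji] := eqVneq j i.
  rewrite (_ : _ \o _ = V i \o fst).
    exact: (measurableT_comp (measurable_funPT (V i))).
  by apply/funext => w; rewrite /= tnth_mktuple eqxx.
rewrite (_ : _ \o _ = V j \o snd).
  exact: (measurableT_comp (measurable_funPT (V j))).
by apply/funext => w; rewrite /= !tnth_mktuple (negbTE ji).
Qed.

Let rectangle (A : 'I_n -> set R) :
  value_profile V @^-1` profiles A = \bigcap_(j in [set: 'I_n]) (V j @^-1` A j).
Proof.
apply/seteqP; split=> w Aw j; first by move=> _; have := Aw j; rewrite tnth_mktuple.
by rewrite tnth_mktuple; exact: Aw.
Qed.

Lemma resample_law (i : 'I_n) (B : set (profile R n)) : measurable B ->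
  (P \x P)%E (resample i @^-1` B) = P (value_profile V @^-1` B).
Proof.
move: B; pose Gs := [set profiles A | A in
    [set A : 'I_n -> set R | forall i, measurable (A i)]] : set (set (profile R n)).
have mV := measurable_value_profile; have mr := measurable_resample i.
apply: (measure_unique Gs (fun=> setT) measurable_profileE _ _ _
  (pushforward (P \x P)%E (resample i)) (pushforward P (value_profile V))).
- move=> _ _ [A mA <-] [B mB <-]; exists (fun j => A j `&` B j).
    by move=> j; exact: measurableI.
  by apply/seteqP; split=> v; [move=> AB; split=> j; have [] := AB j|
    move=> [Av Bv] j; split; [exact: Av|exact: Bv]].
- move=> _; exists (fun=> setT) => //.
  by apply/seteqP; split.
- by rewrite bigcup_const//; exists 0%N.
- move=> _ [A mA <-]; rewrite /= /pushforward.
  (* Freeing coordinate [i] turns the event about the rivals into a rectangle, to which independence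
     applies again. *)
  pose A' j := if j == i then setT else A j.
  have mA' j : measurable (A' j) by rewrite /A'; case: ifP.
  have -> : resample i @^-1` profiles A =
      (V i @^-1` A i) `*` (value_profile V @^-1` profiles A').
    apply/seteqP; split=> [w Aw|w [Aiw Aw] j].
      split; first by have := Aw i; rewrite tnth_mktuple eqxx.
      move=> j; rewrite tnth_mktuple /A'; case: ifPn => // ji.
      by have := Aw j; rewrite tnth_mktuple (negbTE ji) tnth_mktuple.
    rewrite tnth_mktuple; case: eqP => [->//|/eqP ji].
    by have := Aw j; rewrite /A' (negbTE ji).
  rewrite product_measure1E//; last 2 first.
    exact: measurable_funPTI.
    by rewrite -[X in measurable X]setTI; apply: mV => //; exact: measurable_profiles.
  rewrite !rectangle (V_independent mA) (bigD1 i)//=.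
  have -> : P (\bigcap_j (V j @^-1` A' j)) = (\prod_(j < n | j != i) P (V j @^-1` A j))%E.
    rewrite (V_independent mA') (bigD1 i)//= {1}/A' eqxx.
    rewrite preimage_setT probability_setT mul1e.
    by apply: eq_bigr => j ji; rewrite /A' (negbTE ji).
  by [].
- move=> _; rewrite /= /pushforward preimage_setT.
  by rewrite probability_setT ltry.
Qed.

Lemma ge0_resample (i : 'I_n) (g : profile R n -> \bar R) :
  measurable_fun [set: profile R n] g -> (forall v, (0 <= g v)%E) ->
  (\int[P]_w g (value_profile V w) =
   \int[P]_x \int[P]_y g (resample i (x, y)))%E.
Proof.
move=> mg g0.
rewrite -(ge0_integral_same_law (measurable_resample i) measurable_value_profile
  (@resample_law i))//.
by rewrite fubini_tonelli1//; exact: (measurableT_comp mg (measurable_resample i)).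
Qed.

Lemma ge0_resample_swap (i : 'I_n) (g : profile R n -> \bar R) :
  measurable_fun [set: profile R n] g -> (forall v, (0 <= g v)%E) ->
  (\int[P]_w g (value_profile V w) =
   \int[P]_y \int[P]_x g (resample i (x, y)))%E.
Proof.
move=> mg g0.
rewrite -(ge0_integral_same_law (measurable_resample i) measurable_value_profile
  (@resample_law i))//.
by rewrite fubini_tonelli2//; exact: (measurableT_comp mg (measurable_resample i)).
Qed.

Lemma integrable_resample (i : 'I_n) (g : profile R n -> \bar R) :
  measurable_fun [set: profile R n] g ->
  P.-integrable [set: Omega] (g \o value_profile V) ->
  (P \x P)%E.-integrable [set: Omega * Omega] (g \o resample i).
Proof.
exact: (integrable_same_law (measurable_resample i) measurable_value_profile
  (@resample_law i)).
Qed.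

Lemma integral_resample (i : 'I_n) (g : profile R n -> \bar R) :
  measurable_fun [set: profile R n] g ->
  P.-integrable [set: Omega] (g \o value_profile V) ->
  (\int[P]_w g (value_profile V w) =
   \int[P]_x \int[P]_y g (resample i (x, y)))%E.
Proof.
move=> mg ig.
rewrite -(integral_same_law (measurable_resample i) measurable_value_profile
  (@resample_law i))//.
by rewrite -fubini1//; exact: integrable_resample.
Qed.

End resampling.

(** * The Myerson auction *)

Section envelope.
Context (R : realType) (A : set R) (A_ge0 : forall s, A s -> 0 <= s)
  (A_up : forall s s', s <= s' -> A s -> A s').

Let lbA : has_lbound A. Proof. by exists 0 => s /A_ge0. Qed.

Lemma inf_up_le s : A s -> inf A <= s.
Proof. by move=> As; apply: ge_inf. Qed.

Lemma up_of_inf_lt s : A !=set0 -> inf A < s -> A s.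
Proof. by move=> A0 /(inf_lt A0)[t At ts]; apply: A_up At; exact: ltW. Qed.

(** For a winner the integral is the length of [A] below [s], squeezed between the half-open and the
    closed interval from [inf A] to [s]. *)
Lemma envelope_threshold s :
  s * (s \in A)%:R - \int[lebesgue_measure]_(z in `]-oo, s]) ((z \in A)%:R : R) =
  inf A * (s \in A)%:R.
Proof.
have mA : measurable A.
  apply: is_interval_measurable => x y Ax Ay z /andP[xz _].
  exact: A_up xz Ax.
have -> : (fun z => (z \in A)%:R : R) = \1_A by apply/funext => z; rewrite indicE.
rewrite /Rintegral integral_indic//.
case: (boolP (s \in A)) => [|]; last first.
  rewrite notin_setE => As; rewrite !mulr0 sub0r.
  rewrite (_ : A `&` _ = set0) ?measure0 ?oppr0// -subset0 => z [Az].
  by rewrite /= in_itv/= => zs; apply: As; exact: A_up zs Az.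
rewrite inE => As; rewrite !mulr1.
have ps := inf_up_le As.
rewrite (_ : fine _ = s - inf A) ?subKr//.
apply: (congr1 fine (y := (s - inf A)%:E)).
have mAs : measurable (A `&` `]-oo, s]) by exact: measurableI.
apply/eqP; rewrite eq_le; apply/andP; split.
  apply: (@le_trans _ _ (lebesgue_measure `[inf A, s])).
    apply: le_measure; rewrite ?inE// => z [Az].
    by rewrite /= !in_itv/= => ->; rewrite inf_up_le.
  by rewrite lebesgue_measure_itv/= lte_fin; case: ltP => // ?; rewrite lee_fin subr_ge0.
apply: (@le_trans _ _ (lebesgue_measure `]inf A, s])).
  rewrite lebesgue_measure_itv/= lte_fin; case: ltP => // ?.
  by rewrite lee_fin subr_le0.
apply: le_measure; rewrite ?inE// => z; rewrite /= !in_itv/= => /andP[pz zs].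
by split => //; apply: up_of_inf_lt => //; exists s.
Qed.

End envelope.

Section auction.
Context (d : measure_display) (Omega : measurableType d) (R : realType)
  (P : probability Omega R) (n : nat) (V : 'I_n -> {RV P >-> R})
  (f : 'I_n -> R -> R) (rank : 'I_n -> nat) (rank_inj : injective rank).

Let phi (i : 'I_n) : R -> \bar R := myerson_value (V i) (f i).
Context (phi_nd : forall i, {homo phi i : x y / x <= y >-> (x <= y)%E})
  (phi_lt0 : forall i x, x < 0 -> (phi i x < 0)%E).

Let winner := myerson_winner V f rank.
Let alloc := myerson_alloc V f rank.
Let payment := myerson_payment V f rank.

Lemma tnth_deviate (v : profile R n) i r j :
  tnth (deviate v i r) j = if j == i then r else tnth v j.
Proof. by rewrite tnth_mktuple. Qed.

Lemma deviate_deviate (v : profile R n) i r s :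
  deviate (deviate v i r) i s = deviate v i s.
Proof.
by apply: eq_from_tnth => j; rewrite !tnth_deviate; case: eqP.
Qed.

Lemma deviate_id (v : profile R n) i : deviate v i (tnth v i) = v.
Proof. by apply: eq_from_tnth => j; rewrite tnth_deviate; case: eqP => // ->. Qed.

Let winnerP (v : profile R n) i : reflect
  ((0 <= phi i (tnth v i))%E /\ forall j, j != i ->
    (phi j (tnth v j) < phi i (tnth v i))%E \/
    phi j (tnth v j) = phi i (tnth v i) /\ (rank i < rank j)%N)
  (winner v i).
Proof.
apply: (iffP andP) => -[pos best]; split=> //.
  move=> j ji; move/forallP/(_ j)/implyP/(_ ji) : best.
  by move=> /orP[|/andP[/eqP]]; [left|right].
apply/forallP => j; apply/implyP => /best[lt|[eq rij]]; apply/orP; first by left.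
by right; apply/andP; split => //; apply/eqP.
Qed.

Let winner_unique v i j : winner v i -> winner v j -> i = j.
Proof.
move=> /winnerP[_ wi] /winnerP[_ wj]; apply/eqP/negPn/negP => ij.
have ij' : j != i by rewrite eq_sym.
have [ji|[ji rji]] := wi j ij'; have [ltij|[eqij rij]] := wj i ij.
- by have := lt_trans ji ltij; rewrite ltxx.
- by move: ji; rewrite eqij ltxx.
- by move: ltij; rewrite ji ltxx.
- by have := ltn_trans rij rji; rewrite ltnn.
Qed.

Let winner_exists v i : (0 <= phi i (tnth v i))%E ->
  exists2 w, winner v w & forall j, (phi j (tnth v j) <= phi w (tnth v w))%E.
Proof.
move=> pos.
have [m _ Hm] := @Order.TotalTheory.arg_maxP _ _ _ i predT
  (fun j => phi j (tnth v j)) isT.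
pose M := [pred j | phi j (tnth v j) == phi m (tnth v m)].
have Mm : M m by rewrite /M /= eqxx.
have [w /eqP wm Hw] := arg_minnP rank Mm.
exists w; last by move=> j; rewrite wm; exact: Hm.
apply/winnerP; split; first by rewrite wm (le_trans pos)//; exact: Hm.
move=> j jw; rewrite wm.
have : (phi j (tnth v j) <= phi m (tnth v m))%E := Hm j isT.
rewrite le_eqVlt => /orP[/eqP jm|]; last by left.
right; split => //; rewrite ltn_neqAle Hw ?andbT; last by rewrite /M /= jm.
by apply: contra_neq jw => /rank_inj.
Qed.

Lemma alloc_ge0 i v : 0 <= alloc i v. Proof. exact: ler0n. Qed.

Lemma sum_alloc_le1 v : \sum_(i < n) alloc i v <= 1.
Proof.
have [[w ww]|none] := pselect (exists w, winner v w).
  rewrite (bigD1 w)//= big1 => [|j jw].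
    by rewrite addr0 /alloc /myerson_alloc -/(winner v w) ww.
  rewrite /alloc /myerson_alloc -/(winner v j); case: (boolP (winner v j)) => // wj.
  by move: jw; rewrite (winner_unique wj ww) eqxx.
rewrite big1// => j _; rewrite /alloc /myerson_alloc -/(winner v j).
by case: (boolP (winner v j)) => // wj; case: none; exists j.
Qed.

Lemma virtual_surplus_le (v : profile R n) (x : 'I_n -> R) (K : R) :
  (forall i, 0 <= x i) -> \sum_(i < n) x i <= K ->
  (\sum_(i < n) maxe 0 (phi i (tnth v i)) * (x i)%:E <=
   K%:E * \sum_(i < n) maxe 0 (phi i (tnth v i)) * (alloc i v)%:E)%E.
Proof.
move=> x0 xK; set m := (\sum_(i < n) maxe 0 (phi i (tnth v i)) * (alloc i v)%:E)%E.
have pos0 i : (0 <= maxe 0%E (phi i (tnth v i)))%E by rewrite le_max lexx.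
have m0 : (0 <= m)%E by apply: sume_ge0 => i _; rewrite mule_ge0// lee_fin alloc_ge0.
have le_m i : (maxe 0%E (phi i (tnth v i)) <= m)%E.
  case: (boolP (0 <= phi i (tnth v i))%E) => [pos|]; last first.
    by rewrite -ltNge => /ltW neg; rewrite max_l.
  have [w ww Hw] := winner_exists pos.
  apply: (@le_trans _ _ (maxe 0%E (phi w (tnth v w)))).
    by rewrite ge_max le_max lexx /= le_max Hw orbT.
  rewrite /m (bigD1 w)//= /alloc /myerson_alloc -/(winner v w) ww mule1.
  by rewrite leeDl//; apply: sume_ge0 => j _; rewrite mule_ge0// lee_fin ler0n.
apply: (@le_trans _ _ (\sum_(i < n) m * (x i)%:E)%E).
  by apply: lee_sum => i _; rewrite lee_wpmul2r// lee_fin.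
rewrite -ge0_sume_distrr//; last by move=> i _; rewrite lee_fin.
by rewrite muleC sumEFin; apply: lee_wpmul2r => //; rewrite lee_fin.
Qed.

Definition winning_reports (i : 'I_n) (v : profile R n) : set R :=
  [set s | winner (deviate v i s) i].

Lemma winning_reports_ge0 i v s : winning_reports i v s -> 0 <= s.
Proof.
move=> /winnerP[+ _]; rewrite tnth_deviate eqxx => pos.
by rewrite leNgt; apply/negP => /(phi_lt0 i); rewrite ltNge pos.
Qed.

Lemma winning_reports_up i v s s' : s <= s' ->
  winning_reports i v s -> winning_reports i v s'.
Proof.
move=> ss /winnerP[+ best]; rewrite tnth_deviate eqxx => pos.
have le := phi_nd i ss.
apply/winnerP; rewrite !tnth_deviate eqxx; split; first exact: le_trans le.
move=> j ji; have := best j ji; rewrite !tnth_deviate eqxx (negbTE ji).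
move=> [lt|[eq rij]]; first by left; exact: lt_le_trans le.
by move: le; rewrite le_eqVlt -eq => /orP[/eqP ->|]; [right|left].
Qed.

Lemma winning_reports_threshold i v : exists (c : \bar R) (b : bool), (0 <= c)%E /\
  forall s, winning_reports i v s <->
    if b then (c <= phi i s)%E else (c < phi i s)%E.
Proof.
pose c := \big[maxe/0%E]_(j < n | j != i) phi j (tnth v j).
(* If no rival attains [c], then [c] is the reserve level 0 and [b] holds vacuously: a virtual value
   of 0 wins. *)
pose b := [forall j, (j != i) ==> (phi j (tnth v j) == c) ==> (rank i < rank j)%N].
have c0 : (0 <= c)%E by exact: bigmax_ge_id.
have jc j : j != i -> (phi j (tnth v j) <= c)%E.
  by move=> ji; apply: (le_bigmax_cond _ (fun j => phi j (tnth v j))).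
have cP : c = 0%E \/ exists2 j, j != i & phi j (tnth v j) = c.
  rewrite /c; elim/big_ind : _ => [|x y Hx Hy|j ji]; [by left| |by right; exists j].
  by rewrite /maxe; case: ifP.
exists c, b; split => // s.
have -> : winning_reports i v s <-> (0 <= phi i s)%E /\ forall j, j != i ->
    (phi j (tnth v j) < phi i s)%E \/
    phi j (tnth v j) = phi i s /\ (rank i < rank j)%N.
  split=> [/winnerP|[pos best]].
    rewrite tnth_deviate eqxx => -[pos best]; split => // j ji.
    by have := best j ji; rewrite tnth_deviate (negbTE ji).
  apply/winnerP; rewrite tnth_deviate eqxx; split => // j ji.
  by rewrite tnth_deviate (negbTE ji); exact: best.
split=> [[pos best]|].
  have cs : (c <= phi i s)%E.
    by case: cP => [->//|[j ji <-]]; have [/ltW|[->]] := best j ji.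
  case: (boolP b) => // /forallPn[j]; rewrite !negb_imply => /and3P[ji /eqP jeq rji].
  have [|[_ rij]] := best j ji; first by rewrite jeq.
  by rewrite rij in rji.
have win_gt : (c < phi i s)%E -> (0 <= phi i s)%E /\ forall j, j != i ->
    (phi j (tnth v j) < phi i s)%E \/
    phi j (tnth v j) = phi i s /\ (rank i < rank j)%N.
  move=> cs; split; first by rewrite (le_trans c0)// ltW.
  by move=> j ji; left; rewrite (le_lt_trans (jc j ji)).
case: (boolP b) => [/forallP bb|_ //].
rewrite le_eqVlt => /orP[/eqP cs|//]; split; first by rewrite -cs.
move=> j ji; have := jc j ji; rewrite le_eqVlt => /orP[/eqP je|]; last by rewrite cs; left.
by right; split; [rewrite je|have := bb j; rewrite ji je eqxx].
Qed.

Lemma alloc_deviate i v s : alloc i (deviate v i s) = (s \in winning_reports i v)%:R.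
Proof.
rewrite /alloc /myerson_alloc -/(winner _ i); congr (nat_of_bool _)%:R.
by apply/idP/idP; rewrite inE.
Qed.

Lemma payment_deviate i v s :
  payment i (deviate v i s) = inf (winning_reports i v) * alloc i (deviate v i s).
Proof.
rewrite /payment /myerson_payment -/alloc tnth_deviate eqxx.
have -> : (fun z => alloc i (deviate (deviate v i s) i z)) =
    (fun z => (z \in winning_reports i v)%:R).
  by apply/funext => z; rewrite deviate_deviate alloc_deviate.
rewrite alloc_deviate; apply: envelope_threshold.
  exact: winning_reports_ge0.
exact: winning_reports_up.
Qed.

Lemma payment_ge0 i v : 0 <= payment i v.
Proof.
rewrite -[v](deviate_id v i) payment_deviate mulr_ge0 ?alloc_ge0//.
have [->|/set0P A0] := eqVneq (winning_reports i v) set0; first by rewrite inf0.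
by apply: lb_le_inf => // s; exact: winning_reports_ge0.
Qed.

Lemma payment_le_report i v s : payment i (deviate v i s) <= s * alloc i (deviate v i s).
Proof.
rewrite payment_deviate alloc_deviate; case: (boolP (s \in _)) => [|_].
  by rewrite inE !mulr1 => /(inf_up_le (@winning_reports_ge0 i v)).
by rewrite !mulr0.
Qed.

(** The price does not depend on the builder's own report, which only decides whether to buy; truth
    buys exactly when [x] wins, and then [x] is at least the price. *)
Lemma truthful_best i v x r :
  x * alloc i (deviate v i r) - payment i (deviate v i r) <=
  x * alloc i (deviate v i x) - payment i (deviate v i x).
Proof.
rewrite !payment_deviate -!mulrBl !alloc_deviate.
case: (boolP (x \in _)) => [|xA].
  rewrite inE mulr1 => /(inf_up_le (@winning_reports_ge0 i v)) px.
  by rewrite ler_piMr ?subr_ge0// lern1 leq_b1.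
rewrite mulr0; case: (boolP (r \in _)) => [|_]; last by rewrite mulr0.
rewrite inE mulr1 subr_le0 => Ar; apply: lb_le_inf; first by exists r.
move=> s As; rewrite leNgt; apply/negP => /ltW sx.
by move: xA; rewrite notin_setE; apply; exact: winning_reports_up sx As.
Qed.

Lemma payment_bound i v : `|payment i v| <= `|tnth v i|.
Proof.
rewrite ger0_norm ?payment_ge0// -{1}[v](deviate_id v i).
rewrite (le_trans (payment_le_report _ _ _))// (le_trans (ler_norm _))//.
rewrite normrM ler_piMr// ger0_norm ?alloc_ge0//.
by rewrite /alloc /myerson_alloc lern1 leq_b1.
Qed.

Let measurable_phi_tnth j :
  measurable_fun [set: profile R n] (fun v : profile R n => phi j (tnth v j)).
Proof.
apply: (measurableT_comp (nondecreasing_emeasurable (phi_nd j))).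
exact: (@measurable_tnth _ (measurableTypeR R)).
Qed.

Lemma measurable_alloc i : measurable_fun [set: profile R n] (alloc i).
Proof.
pose W := [set v | winner v i].
have -> : alloc i = \1_W.
  apply/funext => v; rewrite indicE /alloc /myerson_alloc -/(winner v i).
  by congr (nat_of_bool _)%:R; apply/idP/idP; rewrite inE.
suff mW : measurable W by exact: measurable_indic.
have mlt (g h : profile R n -> \bar R) : measurable_fun setT g -> measurable_fun setT h ->
    measurable [set v | (g v < h v)%E].
  by move=> mg mh; rewrite -[X in measurable X]setTI; exact: measurable_lte.
have mle (g h : profile R n -> \bar R) : measurable_fun setT g -> measurable_fun setT h ->
    measurable [set v | (g v <= h v)%E].
  by move=> mg mh; rewrite -[X in measurable X]setTI; exact: measurable_lee.
pose B j := [set v : profile R n | (phi j (tnth v j) < phi i (tnth v i))%E] `|`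
  ([set v : profile R n | (phi j (tnth v j) <= phi i (tnth v i))%E] `&`
   [set v : profile R n | (phi i (tnth v i) <= phi j (tnth v j))%E] `&`
   [set v | (rank i < rank j)%N]).
have -> : W = [set v : profile R n | (0 <= phi i (tnth v i))%E] `&`
    \bigcap_(j in [set j | j != i]) B j.
  apply/seteqP; split=> [v /winnerP[pos best]|v [pos best]].
    split => // j /best[lt|[eq rij]]; first by left.
    by right; split => //=; rewrite eq.
  apply/winnerP; split => // j /best[lt|[[/= le1 le2] rij]]; first by left.
  by right; split => //; apply/le_anti; rewrite le1.
apply: measurableI; first exact: mle.
apply: fin_bigcap_measurable; first exact: finite_finset.
move=> j _; apply: measurableU; first exact: mlt.
apply: measurableI; first by apply: measurableI; exact: mle.
by case: (rank i < rank j)%N; [rewrite (_ : [set _ | _] = setT)|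
  rewrite (_ : [set _ | _] = set0)] => //; apply/seteqP; split.
Qed.

Lemma measurable_payment i : measurable_fun [set: profile R n] (payment i).
Proof.
apply: measurable_funB.
  apply: measurable_funM; last exact: measurable_alloc.
  exact: (@measurable_tnth _ (measurableTypeR R)).
(* The upper limit of the integral moves with the profile; as an indicator on the product space it
   lets Tonelli give measurability. *)
pose g (z : profile R n * measurableTypeR R) : \bar R :=
  (alloc i (deviate z.1 i z.2) * (z.2 <= tnth z.1 i)%R%:R)%:E.
have mg : measurable_fun [set: profile R n * measurableTypeR R] g.
  apply/measurable_EFinP; apply: measurable_funM.
    exact: (measurableT_comp (measurable_alloc i) (measurable_deviate i)).
  pose B := [set z : profile R n * measurableTypeR R | z.2 <= tnth z.1 i].
  rewrite (_ : (fun _ => _) = \1_B); last first.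
    by apply/funext => z; rewrite indicE; congr (nat_of_bool _)%:R; apply/idP/idP; rewrite inE.
  apply: measurable_indic; rewrite -[B]setTI.
  apply: (measurable_lee measurableT (f := EFin \o snd)
    (g := fun z : profile R n * measurableTypeR R => (tnth z.1 i)%:E)).
    by apply/measurable_EFinP; exact: measurable_snd.
  apply/measurable_EFinP.
  exact: (measurableT_comp (@measurable_tnth _ (measurableTypeR R) n i) measurable_fst).
have g0 z : (0 <= g z)%E by rewrite lee_fin mulr_ge0 ?alloc_ge0.
have mF := measurable_fun_fubini_tonelli_F (m2 := lebesgue_measure) g mg g0.
have := measurableT_comp (@fine_measurable R _ measurableT) mF.
apply: eq_measurable_fun => v _; rewrite /= /fubini_F /Rintegral.
congr fine; rewrite [RHS]integral_mkcond; apply: eq_integral => s _.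
rewrite patchE /g /=; case: ifPn => [|/negP].
  by rewrite inE/= in_itv/= => ->; rewrite mulr1.
rewrite inE/= in_itv/= => /negP/negbTE ->; rewrite mulr0//.
Qed.

End auction.

(** * Revenue *)

Section revenue.
Context (d : measure_display) (Omega : measurableType d) (R : realType)
  (P : probability Omega R) (n : nat) (V : 'I_n -> {RV P >-> R})
  (T : 'I_n -> set R) (f : 'I_n -> R -> R) (k : stage -> R) (rank : 'I_n -> nat)
  (rank_inj : injective rank)
  (k_ge0 : 0 <= k stage2) (k_le : k stage2 <= k stage1) (k_le1 : k stage1 <= 1)
  (T_measurable : forall i, measurable (T i))
  (V_in_T : forall i w, T i (V i w))
  (V_independent : independent_values V)
  (V_density : forall i, has_density (V i) (f i))
  (V_integrable : forall i, P.-integrable [set: Omega] (EFin \o V i)).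

Let phi (i : 'I_n) : R -> \bar R := myerson_value (V i) (f i).
Let pos (i : 'I_n) (x : R) : \bar R := maxe 0%E (phi i x).
Let alloc := myerson_alloc V f rank.
Let payment := myerson_payment V f rank.
Let vp := value_profile V.

Let phi_nd i : {homo phi i : x y / x <= y >-> (x <= y)%E}.
Proof. exact: (myerson_value_nondecreasing (V_integrable i) (V_density i)). Qed.

Let phi_lt0 i x : x < 0 -> (phi i x < 0)%E.
Proof. exact: (myerson_value_lt0 (V_integrable i) (V_density i)). Qed.

Let phi_opt i : optimal_pricing (sale_prob (V i)) (phi i).
Proof. exact: (myerson_value_optimal (V_integrable i) (V_density i)). Qed.

Let pos_ge0 i x : (0 <= pos i x)%E. Proof. by rewrite /pos le_max lexx. Qed.

Let measurable_pos i :
  measurable_fun [set: profile R n] (fun v : profile R n => pos i (tnth v i)).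
Proof.
apply: measurable_maxe => //.
apply: (measurableT_comp (nondecreasing_emeasurable (phi_nd i))).
exact: (@measurable_tnth _ (measurableTypeR R)).
Qed.

Let malloc i : measurable_fun [set: profile R n] (alloc i).
Proof. exact: measurable_alloc. Qed.

Let mpayment i : measurable_fun [set: profile R n] (payment i).
Proof. exact: measurable_payment. Qed.

Let tnth_vp i w : tnth (vp w) i = V i w. Proof. exact: tnth_mktuple. Qed.

Let tnth_resample i z : tnth (resample V i z) i = V i z.1.
Proof. by rewrite tnth_deviate eqxx. Qed.

(** With the rivals' values fixed in the outer integral, the winning reports form a fixed upper set
    and the payment is a posted price at its infimum, so [threshold_price_ge] bounds the inner
    integral. *)
Lemma virtual_surplus_le_payment i :
  (\int[P]_w (pos i (V i w) * (alloc i (vp w))%:E) <=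
   \int[P]_w (payment i (vp w))%:E)%E.
Proof.
pose g (v : profile R n) : \bar R := (pos i (tnth v i) * (alloc i v)%:E)%E.
have mg : measurable_fun [set: profile R n] g.
  by apply: emeasurable_funM => //; apply/measurable_EFinP.
have g0 v : (0 <= g v)%E by rewrite mule_ge0// lee_fin alloc_ge0.
have pay0 v : (0 <= (payment i v)%:E)%E by rewrite lee_fin payment_ge0.
have mpay : measurable_fun [set: profile R n] (EFin \o payment i).
  exact/measurable_EFinP.
have -> : (\int[P]_w (pos i (V i w) * (alloc i (vp w))%:E) = \int[P]_w g (vp w))%E.
  by apply: eq_integral => w _; rewrite /g tnth_vp.
rewrite (ge0_resample_swap V_independent i mg g0).
rewrite (ge0_resample_swap V_independent i mpay pay0).
have mr := measurable_resample V i.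
apply: ge0_le_integral => //.
- by move=> y _; apply: integral_ge0.
- apply: (measurable_fun_fubini_tonelli_G (m1 := P) (g \o resample V i)).
    exact: measurableT_comp.
  by move=> z; exact: g0.
- apply: (measurable_fun_fubini_tonelli_G (m1 := P) (EFin \o payment i \o resample V i)).
    exact: measurableT_comp.
  by move=> z; exact: pay0.
move=> y _; pose A := winning_reports V f rank i (vp y).
pose E := [set x | A (V i x)].
have EA x : (x \in E) = (V i x \in A).
  by apply/idP/idP => /set_mem ?; exact/mem_set.
have allocE x : alloc i (resample V i (x, y)) = (V i x \in A)%:R.
  exact: alloc_deviate.
have [A0|/set0P A0] := eqVneq A set0.
  rewrite integral0_eq; first by apply: integral_ge0 => x _; exact: pay0.
  by move=> x _; rewrite /g allocE A0 in_set0 mule0.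
have [c [b [c0 Ac]]] := @winning_reports_threshold _ _ _ _ _ V f rank i (vp y).
have A_ge0 s : A s -> 0 <= s.
  by apply: winning_reports_ge0 => j x; exact: phi_lt0.
have A_up s s' : s <= s' -> A s -> A s'.
  by apply: winning_reports_up => j x z; exact: phi_nd.
have price : (\int[P]_(x in E) pos i (V i x) <= (inf A)%:E * P E)%E.
  apply: (threshold_price_ge (V_integrable i) (V_density i) (@phi_nd i) (@phi_lt0 i)
    (@phi_opt i) c0 (b := b)) => [x|s /Ac|s sA]; first exact: Ac.
    exact: inf_up_le.
  by apply/Ac; exact: up_of_inf_lt.
have mA : measurable A.
  by apply: is_interval_measurable => s t As _ u /andP[su _]; exact: A_up su As.
have mE : measurable E by exact: measurable_funPTI.
have -> : (\int[P]_x g (resample V i (x, y)) = \int[P]_(x in E) pos i (V i x))%E.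
  rewrite [RHS]integral_mkcond; apply: eq_integral => x _.
  rewrite /g tnth_resample allocE patchE EA.
  by case: (V i x \in A); rewrite ?mule1 ?mule0.
apply: le_trans price _.
rewrite -(integral_cst P mE) [leLHS]integral_mkcond le_eqVlt; apply/orP; left; apply/eqP.
apply: eq_integral => x _; rewrite [RHS]/=.
have -> : payment i (resample V i (x, y)) =
    inf A * (V i x \in A)%:R.
  by rewrite -allocE; apply: payment_deviate => j; [exact: phi_nd|exact: phi_lt0].
by rewrite patchE EA; case: (V i x \in A); rewrite ?mulr1 ?mulr0.
Qed.

Let integrable_bounded (g : Omega -> R) (K : R) : measurable_fun [set: Omega] g ->
  (forall w, `|g w| <= K) -> P.-integrable [set: Omega] (EFin \o g).
Proof.
move=> mg gK; have iK : P.-integrable [set: Omega] (EFin \o cst K).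
  by apply: finite_measure_integrable_cst.
apply: (le_integrable measurableT _ _ iK); first exact/measurable_EFinP.
by move=> w _; rewrite /= lee_fin (le_trans (gK w))// ler_norm.
Qed.

Let measurable_vp_deviate i r :
  measurable_fun [set: Omega] (fun w => deviate (vp w) i r).
Proof.
apply: (measurableT_comp (measurable_deviate i) (g := fun w => (vp w, r))).
apply/measurable_fun_pairP; split; last exact: measurable_cst.
exact: measurable_value_profile.
Qed.

(** * Revenue bound for an arbitrary admissible mechanism *)

Section admissible.
Context (M : mechanism R n) (M_admissible : admissible V k T M).

Let win_ge0 v : profiles T v -> forall i t, 0 <= win M i t v.
Proof. by have [[ge0 _ _ _ _] _ _] := M_admissible; exact: ge0. Qed.

Let D := profiles T.
Let mD : measurable D. Proof. exact: measurable_profiles. Qed.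

Let D_vp w : D (vp w). Proof. by move=> i; rewrite tnth_vp. Qed.

Let D_deviate w i r : T i r -> D (deviate (vp w) i r).
Proof. by move=> Tr j; rewrite tnth_deviate tnth_vp; case: eqP => // ->. Qed.

(* The mechanism need not be measurable outside [profiles T]. *)
Let ww i (v : profile R n) : R := if v \in D then weighted_win k M i v else 0.
Let wp i (v : profile R n) : R := if v \in D then weighted_pay k M i v else 0.

Let wwE i v : D v -> weighted_win k M i v = ww i v.
Proof. by move=> Dv; rewrite /ww mem_set. Qed.

Let wpE i v : D v -> weighted_pay k M i v = wp i v.
Proof. by move=> Dv; rewrite /wp mem_set. Qed.

Let measurable_on_D (g : profile R n -> R) : measurable_fun D g ->
  measurable_fun [set: profile R n] (fun v => if v \in D then g v else 0).
Proof. by move=> mg; have /(measurable_restrictT g mD) := mg. Qed.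

Let mww i : measurable_fun [set: profile R n] (ww i).
Proof.
apply: measurable_on_D; apply: measurable_sum => t; apply: measurable_funM => //.
by have [[_ _ mwin _ _] _ _] := M_admissible; exact: mwin.
Qed.

Let mwp i : measurable_fun [set: profile R n] (wp i).
Proof.
apply: measurable_on_D; apply: measurable_sum => t; apply: measurable_funM => //.
by have [[_ _ _ mpay _] _ _] := M_admissible; exact: mpay.
Qed.

Let k_stage t : 0 <= k t <= k stage1.
Proof.
have [->|->] : t = stage1 \/ t = stage2.
  by case: t => -[|[|//]] tt; [left|right]; exact: val_inj.
- by rewrite lexx andbT (le_trans k_ge0).
- by rewrite k_ge0.
Qed.

Let ww_ge0 i v : 0 <= ww i v.
Proof.
rewrite /ww; case: ifPn => //; rewrite inE => Dv.
by apply: sumr_ge0 => t _; rewrite mulr_ge0 ?win_ge0//; have /andP[] := k_stage t.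
Qed.

Let sum_ww_le v : \sum_(i < n) ww i v <= k stage1.
Proof.
have k1 : 0 <= k stage1 by rewrite (le_trans k_ge0).
have [Dv|Dv] := pselect (D v); last first.
  by rewrite big1// => i _; rewrite /ww memNset.
have [[_ /(_ v Dv) sum1 _ _ _] _ _] := M_admissible.
apply: (@le_trans _ _ (k stage1 * \sum_(i < n) \sum_(t : stage) win M i t v)).
  rewrite mulr_sumr; apply: ler_sum => i _; rewrite -wwE// mulr_sumr.
  apply: ler_sum => t _; rewrite ler_wpM2r ?win_ge0//.
  by have /andP[] := k_stage t.
by rewrite ler_piMr.
Qed.

Let ww_le1 i v : ww i v <= 1.
Proof.
rewrite (le_trans _ k_le1)// (le_trans _ (sum_ww_le v))//.
by rewrite (bigD1 i)//= lerDl sumr_ge0.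
Qed.

Let iwin i r : P.-integrable [set: Omega]
  (fun w => (ww i (deviate (vp w) i r))%:E).
Proof.
apply: (@integrable_bounded (fun w => ww i (deviate (vp w) i r)) 1).
  exact: (measurableT_comp (mww i) (measurable_vp_deviate i r)).
by move=> w; rewrite ger0_norm ?ww_le1.
Qed.

Let ipay_vp i : P.-integrable [set: Omega] (EFin \o wp i \o vp).
Proof.
have [[_ _ _ _ /(_ i)[ip _]] _ _] := M_admissible.
apply: eq_integrable ip => // w _.
by rewrite /= wpE.
Qed.

Let ipay i r : T i r -> P.-integrable [set: Omega]
  (fun w => (wp i (deviate (vp w) i r))%:E).
Proof.
move=> Tr; have [[_ _ _ _ /(_ i)[_ /(_ r Tr) ip]] _ _] := M_admissible.
apply: eq_integrable ip => // w _.
by rewrite /= wpE//; exact: D_deviate.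
Qed.

Let Q i (r : R) : R := fine (\int[P]_w (ww i (deviate (vp w) i r))%:E).
Let Pay i (r : R) : R := fine (\int[P]_w (wp i (deviate (vp w) i r))%:E).

Let interim_payoffE i x r : T i x -> T i r ->
  interim_payoff V k M i x r = (x * Q i r - Pay i r)%:E.
Proof.
move=> Tx Tr; rewrite /interim_payoff unlock.
have := iwin i r => iw; have := ipay Tr => ip.
rewrite (eq_integral (fun w => (x%:E * (ww i (deviate (vp w) i r))%:E -
    (wp i (deviate (vp w) i r))%:E)%E)); last first.
  by move=> w _; rewrite (wwE _ (D_deviate w Tr)) (wpE _ (D_deviate w Tr)).
rewrite integralB//; last exact: integrableZl.
by rewrite integralZl// EFinB EFinM !fineK//; exact: integrable_fin_num.
Qed.

Let U i x := x * Q i x - Pay i x.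

Let U_ge0 i x : T i x -> 0 <= U i x.
Proof.
move=> Tx; have [_ _ /(_ i x Tx)] := M_admissible.
by rewrite interim_payoffE// lee_fin.
Qed.

Let U_convex i x r : T i x -> T i r -> U i r + (x - r) * Q i r <= U i x.
Proof.
move=> Tx Tr; have [_ /(_ i x r Tx Tr) + _] := M_admissible.
by rewrite !interim_payoffE// lee_fin /U; lra.
Qed.

Let Q_ge0 i x : 0 <= Q i x.
Proof. by rewrite fine_ge0// integral_ge0// => w _; rewrite lee_fin. Qed.

Let Q_le1 i x : Q i x <= 1.
Proof.
rewrite -lee_fin fineK; last exact: (integrable_fin_num measurableT (iwin i x)).
apply: (@le_trans _ _ (\int[P]_w cst 1%E w)%E); last first.
  by rewrite integral_cst//= probability_setT mule1.
apply: ge0_le_integral => //.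
- by move=> w _; rewrite lee_fin.
- exact: (measurable_int _ (iwin i x)).
- by move=> w _; rewrite lee_fin.
Qed.

(** Resampling writes the expected payment as the mean of the interim payment, which
    [incentive_bound] controls. The positive part depends on the own value only, so resampling back
    replaces [Q] by the actual winning weight. *)
Lemma expected_payment_le i :
  (\int[P]_w (weighted_pay k M i (vp w))%:E <=
   \int[P]_w (pos i (V i w) * (weighted_win k M i (vp w))%:E))%E.
Proof.
have mr := measurable_resample V i.
have mwwr : measurable_fun [set: Omega * Omega] (EFin \o (ww i \o resample V i)).
  by apply/measurable_EFinP; exact: measurableT_comp.
have iwpr : (P \x P)%E.-integrable [set: Omega * Omega] ((EFin \o wp i) \o resample V i).
  have mE : measurable_fun [set: profile R n] (EFin \o wp i) by exact/measurable_EFinP.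
  exact: (@integrable_resample _ _ _ _ _ V V_independent i (EFin \o wp i) mE (ipay_vp i)).
have mQ : measurable_fun [set: Omega] (Q i \o V i).
  have mF := @measurable_fun_fubini_tonelli_F _ _ _ _ _ P _ mwwr
    (fun z => ww_ge0 i (resample V i z)).
  exact: (measurableT_comp (@fine_measurable R _ measurableT) mF).
have PayE x : (Pay i (V i x))%:E = (\int[P]_y (wp i (resample V i (x, y)))%:E)%E.
  by rewrite fineK//; exact: (integrable_fin_num measurableT (ipay (V_in_T i x))).
have iU : P.-integrable [set: Omega] (fun w => (V i w * Q i (V i w) - U i (V i w))%:E).
  have := integrable_fubini_F iwpr; apply: eq_integrable => // x _.
  by rewrite /U subKr PayE.
have := @incentive_bound _ _ _ _ (V i) (f i) (V_integrable i) (V_density i) (phi i)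
  (@phi_nd i) (@phi_lt0 i) (@phi_opt i) (T i) (U i) (Q i) (V_in_T i) (@U_ge0 i)
  (@U_convex i) (fun x _ => Q_ge0 i x) (fun x _ => Q_le1 i x) mQ iU.
rewrite (eq_integral (fun x => (\int[P]_y (wp i (resample V i (x, y)))%:E)%E)); last first.
  by move=> x _; rewrite /U subKr PayE.
rewrite -(@integral_resample _ _ _ _ _ V V_independent i (EFin \o wp i)) //; last first.
  exact/measurable_EFinP.
rewrite [X in (_ <= X)%E -> _](_ : _ = \int[P]_w (pos i (V i w) * (ww i (vp w))%:E))%E.
  move=> H; rewrite (eq_integral (fun w => (wp i (vp w))%:E)); last first.
    by move=> w _; rewrite wpE.
  rewrite [leRHS](eq_integral (fun w => (pos i (V i w) * (ww i (vp w))%:E)%E))//.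
  by move=> w _; rewrite wwE.
pose g (v : profile R n) : \bar R := (pos i (tnth v i) * (ww i v)%:E)%E.
have mg : measurable_fun [set: profile R n] g.
  by apply: emeasurable_funM => //; apply/measurable_EFinP.
have g0 v : (0 <= g v)%E by rewrite mule_ge0// lee_fin.
transitivity (\int[P]_w g (vp w))%E; last first.
  by apply: eq_integral => w _; rewrite /g tnth_vp.
rewrite (ge0_resample V_independent i mg g0); apply: eq_integral => x _.
rewrite /g; under [RHS]eq_integral do rewrite tnth_resample/=.
rewrite ge0_integralZl//.
- by rewrite fineK//; exact: (integrable_fin_num measurableT (iwin i (V i x))).
- exact: (measurable_int _ (iwin i (V i x))).
- by move=> y _; rewrite lee_fin.
Qed.

Lemma total_payment_le :
  (\sum_(i < n) \int[P]_w (weighted_pay k M i (vp w))%:E <=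
   (k stage1)%:E * \sum_(i < n) \int[P]_w (pos i (V i w) * (alloc i (vp w))%:E))%E.
Proof.
have mposV i : measurable_fun [set: Omega] (fun w => pos i (V i w)).
  have := measurableT_comp (measurable_pos i) (measurable_value_profile V).
  by apply: eq_measurable_fun => w _; rewrite /= tnth_vp.
have mval (g : profile R n -> R) i : measurable_fun [set: profile R n] g ->
    measurable_fun [set: Omega] (fun w => pos i (V i w) * (g (vp w))%:E)%E.
  move=> mg; apply: emeasurable_funM => //; apply/measurable_EFinP.
  exact: (measurableT_comp mg (measurable_value_profile V)).
have k1 : 0 <= k stage1 by rewrite (le_trans k_ge0).
have ge0 i w : (0 <= pos i (V i w) * (alloc i (vp w))%:E)%E.
  by rewrite mule_ge0// lee_fin alloc_ge0.
apply: (@le_trans _ _ (\sum_(i < n) \int[P]_w (pos i (V i w) * (ww i (vp w))%:E))%E).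
  apply: lee_sum => i _; apply: le_trans (expected_payment_le i) _.
  by under eq_integral do rewrite wwE//.
rewrite -ge0_integral_sum//; last 2 first.
- by move=> i; exact: mval.
- by move=> i w _; rewrite mule_ge0// lee_fin.
rewrite -ge0_integral_sum//; last by move=> i; exact: mval.
rewrite -ge0_integralZl//; last 2 first.
- by apply: emeasurable_sum => i; exact: mval.
- by move=> w _; apply: sume_ge0.
apply: ge0_le_integral => //.
- by move=> w _; apply: sume_ge0 => i _; rewrite mule_ge0// lee_fin.
- by apply: emeasurable_sum => i; exact: mval.
- by apply: measurable_funeM; apply: emeasurable_sum => i; exact: mval.
move=> w _.
have := virtual_surplus_le V f rank_inj (vp w) (fun i => ww_ge0 i (vp w)) (sum_ww_le (vp w)).
rewrite (eq_bigr (fun i => pos i (V i w) * (ww i (vp w))%:E)%E); last first.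
  by move=> i _; rewrite tnth_vp.
rewrite [X in (_ <= _ * X)%E -> _](eq_bigr (fun i => pos i (V i w) * (alloc i (vp w))%:E)%E)//.
by move=> i _; rewrite tnth_vp.
Qed.

End admissible.

(** * Admissibility and optimality of the auction held at stage 1 *)

Definition myerson_mechanism : mechanism R n :=
  Mechanism (fun i t v => if t == stage1 then alloc i v else 0)
            (fun i t v => if t == stage1 then payment i v else 0).

Let M0 := myerson_mechanism.

Let weighted_winE i v : weighted_win k M0 i v = k stage1 * alloc i v.
Proof.
rewrite /weighted_win (bigD1 stage1)//= big1 ?addr0// => t /negbTE ->.
by rewrite mulr0.
Qed.

Let weighted_payE i v : weighted_pay k M0 i v = k stage1 * payment i v.
Proof.
rewrite /weighted_pay (bigD1 stage1)//= big1 ?addr0// => t /negbTE ->.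
by rewrite mulr0.
Qed.

Let payment_norm_le i v : `|payment i v| <= `|tnth v i|.
Proof. by apply: payment_bound => j; [exact: phi_nd|exact: phi_lt0]. Qed.

Let k1_ge0 : 0 <= k stage1. Proof. exact: le_trans k_le. Qed.

Let ipayment i : P.-integrable [set: Omega] (fun w => (payment i (vp w))%:E).
Proof.
apply: (le_integrable measurableT _ _ (V_integrable i)).
  apply/measurable_EFinP.
  exact: (measurableT_comp (mpayment i) (measurable_value_profile V)).
by move=> w _; rewrite /= lee_fin -tnth_vp payment_norm_le.
Qed.

Let ipayment_deviate i r : P.-integrable [set: Omega]
  (fun w => (payment i (deviate (vp w) i r))%:E).
Proof.
apply: (@integrable_bounded (fun w => payment i (deviate (vp w) i r)) `|r|).
  exact: (measurableT_comp (mpayment i) (measurable_vp_deviate i r)).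
by move=> w; have := payment_norm_le i (deviate (vp w) i r); rewrite tnth_deviate eqxx.
Qed.

Let ialloc_deviate i r : P.-integrable [set: Omega]
  (fun w => (alloc i (deviate (vp w) i r))%:E).
Proof.
apply: (@integrable_bounded (fun w => alloc i (deviate (vp w) i r)) 1).
  exact: (measurableT_comp (malloc i) (measurable_vp_deviate i r)).
move=> w; rewrite ger0_norm ?alloc_ge0//.
by rewrite /alloc /myerson_alloc lern1 leq_b1.
Qed.

Let integrableM (c : R) (g : Omega -> R) : P.-integrable [set: Omega] (EFin \o g) ->
  P.-integrable [set: Omega] (fun w => (c * g w)%:E).
Proof.
by move=> ig; have := integrableZl measurableT c ig; apply: eq_integrable.
Qed.

Let ipayoff i x r : P.-integrable [set: Omega]
  (fun w => (x * weighted_win k M0 i (deviate (vp w) i r) -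
             weighted_pay k M0 i (deviate (vp w) i r))%:E).
Proof.
have iw := integrableM x (integrableM (k stage1) (ialloc_deviate i r)).
have ip := integrableM (k stage1) (ipayment_deviate i r).
have := integrableB measurableT iw ip; apply: eq_integrable => // w _.
by rewrite /= weighted_winE weighted_payE EFinB.
Qed.

Let myerson_feasible : feasible V k T M0.
Proof.
split.
- by move=> v _ i t /=; case: ifP => // _; exact: alloc_ge0.
- move=> v _; apply: (@le_trans _ _ (\sum_(i < n) alloc i v)); last first.
    exact: (sum_alloc_le1 V f rank v).
  apply: ler_sum => i _.
  by rewrite (bigD1 stage1)//= big1 ?addr0// => t /negbTE ->.
- move=> i t /=; apply: measurable_funTS.
  by case: (t == stage1); [exact: malloc|exact: measurable_cst].
- move=> i t /=; apply: measurable_funTS.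
  by case: (t == stage1); [exact: mpayment|exact: measurable_cst].
- move=> i; split=> [|r _].
    have := integrableM (k stage1) (ipayment i); apply: eq_integrable => // w _.
    by rewrite weighted_payE.
  have := integrableM (k stage1) (ipayment_deviate i r); apply: eq_integrable => // w _.
  by rewrite weighted_payE.
Qed.

(** Truth is best, and earns a nonnegative payoff, against every profile of rivals, so both interim
    inequalities hold under the integral sign. *)
Lemma myerson_admissible : admissible V k T M0.
Proof.
split; first exact: myerson_feasible.
- move=> i x r _ _; rewrite /interim_payoff unlock.
  apply: (le_integral measurableT (ipayoff i x r) (ipayoff i x x)) => w _.
  rewrite lee_fin.
  have : x * alloc i (deviate (vp w) i r) - payment i (deviate (vp w) i r) <=
      x * alloc i (deviate (vp w) i x) - payment i (deviate (vp w) i x).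
    by apply: truthful_best => j; [exact: phi_nd|exact: phi_lt0].
  rewrite (weighted_winE i (deviate (vp w) i r)) (weighted_payE i (deviate (vp w) i r)).
  rewrite (weighted_winE i (deviate (vp w) i x)) (weighted_payE i (deviate (vp w) i x)).
  move: (alloc _ _) (alloc _ _) (payment _ _) (payment _ _) => a1 a2 p1 p2 best.
  by rewrite !(mulrCA x) -!mulrBr ler_wpM2l.
- move=> i x _; rewrite /interim_payoff unlock; apply: integral_ge0 => w _.
  rewrite lee_fin weighted_winE weighted_payE mulrCA -mulrBr mulr_ge0// subr_ge0.
  by apply: payment_le_report => j; [exact: phi_nd|exact: phi_lt0].
Qed.

Let revenueE (M : mechanism R n) : admissible V k T M ->
  revenue V k M = (\sum_(i < n) \int[P]_w (weighted_pay k M i (vp w))%:E)%E.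
Proof.
move=> [[_ _ _ _ ip] _ _]; rewrite /revenue unlock.
rewrite -integral_sum//; last by move=> i; have [] := ip i.
by apply: eq_integral => w _; rewrite sumEFin.
Qed.

Lemma revenue_le_myerson (M : mechanism R n) :
  admissible V k T M -> (revenue V k M <= revenue V k M0)%E.
Proof.
move=> aM; rewrite (revenueE aM) (revenueE myerson_admissible).
apply: le_trans (total_payment_le aM) _.
rewrite [leRHS](_ : _ = (k stage1)%:E *
    \sum_(i < n) \int[P]_w (payment i (vp w))%:E)%E; last first.
  rewrite ge0_sume_distrr; last first.
    by move=> i _; apply: integral_ge0 => w _; rewrite lee_fin payment_ge0.
  apply: eq_bigr => i _; rewrite -integralZl//.
  by apply: eq_integral => w _; rewrite weighted_payE EFinM.
apply: lee_wpmul2l; first by rewrite lee_fin.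
by apply: lee_sum => i _; exact: virtual_surplus_le_payment.
Qed.

End revenue.

Theorem proposition6 (R : realType) (d : measure_display)
  (Omega : measurableType d) (P : probability Omega R) (n : nat)
  (V : 'I_n -> {RV P >-> R}) (T : 'I_n -> set R) (f : 'I_n -> R -> R)
  (k : stage -> R) (rank : 'I_n -> nat)
  (rank_inj : injective rank)
  (k_ge0 : 0 <= k stage2) (k_le : k stage2 <= k stage1) (k_le1 : k stage1 <= 1)
  (T_measurable : forall i, measurable (T i))
  (V_in_T : forall i w, T i (V i w))
  (V_independent : independent_values V)
  (V_density : forall i, has_density (V i) (f i))
  (V_integrable : forall i, P.-integrable [set: Omega] (EFin \o V i)) :
  exists M : mechanism R n,
    revenue_maximizing V k T M /\
    implements_myerson_at_stage1 V f rank T M.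
Proof.
exists (myerson_mechanism V f rank); split; last by [].
split; first exact: myerson_admissible.
move=> M'; exact: revenue_le_myerson.
Qed.
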